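(* Let $P$ be a nonempty set of odd primes and pick an arbitrary indexing $P=\{p_1,\dots,p_{|P|}\}$. Let $\mathcal{M}\subset\mathcal{G}$ be a nonzero $A_P$-submodule spanned by simple $D_{2n}$-modules with $n$ odd, such that for each fixed $n$ either all or none of the simple $D_{2n}$-modules lie in $\mathcal{M}$, and such that there is no simple $D_{2n}$-module in $\mathcal{M}$ with all prime factors of $n$ belonging to $P$. For $p\in P$ put $$T^1_{P,\mathcal{M}}=A_{P,\mathcal{M}}/\langle \mathrm{Res}_p\mathrm{Ind}_p-p\rangle,\qquad T^2_{P,\mathcal{M}}=A_{P,\mathcal{M}}/\langle \mathrm{Res}_p\mathrm{Ind}_p-1\rangle,$$ with natural projections $\pi_i:A_{P,\mathcal{M}}\to T^i_{P,\mathcal{M}}$, $i=1,2$. Then the algebras $T^1_{P,\mathcal{M}}$ and $T^2_{P,\mathcal{M}}$ do not depend on the choice of $p\in P$, and each has a basis consisting of (the images under $\pi_1$, respectively $\pi_2$, of) the monomials of the form $$\mathrm{Ind}_{p_1}^{l_1}\cdots\mathrm{Ind}_{p_{|P|}}^{l_{|P|}}\,\mathrm{Res}_{p_1}^{k_1}\cdots\mathrm{Res}_{p_{|P|}}^{k_{|P|}}$$ with $k_i,l_i\in\mathbb{N}$. Furthermore, fix $q\in P$ and let $\epsilon_1=\frac{\mathrm{Res}_q\mathrm{Ind}_q-1}{q-1}$ and $\epsilon_2=\frac{q-\mathrm{Res}_q\mathrm{Ind}_q}{q-1}$ in $A_{P,\mathcal{M}}$. Then there are isomorphisms $$A_{P,\mathcal{M}}\xrightarrow{\sim}A_{P,\mathcal{M}}\epsilon_1\oplus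 A_{P,\mathcal{M}}\epsilon_2\xrightarrow{\sim}T^1_{P,\mathcal{M}}\oplus T^2_{P,\mathcal{M}},\qquad z\mapsto z\epsilon_1\oplus z\epsilon_2\mapsto\pi_1(z)\oplus\pi_2(z).$$
   Context: All vector spaces are over $\mathbb{C}$; modules are left modules and finite-dimensional; $\mathbb{N}=\{0,1,2,\dots\}$. For an integer $n\ge 3$ let $D_{2n}=\langle r_n,s_n\mid r_n^n=1,\ s_n^2=1,\ s_nr_ns_n=r_n^{-1}\rangle$ be the dihedral group of order $2n$ (dihedral groups are left undefined for $n=1,2$). For a prime $p$, $D_{2n}$ is embedded in $D_{2pn}$ by $r_n\mapsto r_{pn}^p$, $s_n\mapsto s_{pn}$. Let $\mathcal{G}$ be the complexified Grothendieck group of $\bigoplus_{n\ge 3}D_{2n}\text{-mod}$, i.e. the complex vector space with basis the isomorphism classes of simple $D_{2n}$-modules, $n\ge 3$; a module is identified with its class in $\mathcal{G}$. Linear endomorphisms $\mathrm{Ind}_p,\mathrm{Res}_p$ of $\mathcal{G}$ are defined as follows: $\mathrm{Ind}_p$ sends a $D_{2n}$-module to the $D_{2pn}$-module induced from it along the embedding above; $\mathrm{Res}_p$ sends a $D_{2n}$-module to its restriction to $D_{2n/p}$ if $p\mid n$ and $n/p\ge 3$, and to $0$ otherwise. For a set $P$ of primes, $A_P$ is the free unital associative $\mathbb{C}$-algebra on the symbols $\mathrm{Res}_p,\mathrm{Ind}_p$ ($p\in P$), acting on $\mathcal{G}$ by these operators. For an $A_P$-submodule $\mathcal{M}\subset\mathcal{G}$,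 $\mathrm{Ann}_{A_P}(\mathcal{M})$ is the ideal of elements annihilating every element of $\mathcal{M}$, and $A_{P,\mathcal{M}}=A_P/\mathrm{Ann}_{A_P}(\mathcal{M})$; the symbols $\mathrm{Res}_p,\mathrm{Ind}_p$ also denote their images in $A_{P,\mathcal{M}}$. $\langle x\rangle$ in a quotient denotes the two-sided ideal generated by $x$. Convention if $P$ is infinite: the indices run over all positive integers and all but finitely many exponents $k_i,l_i$ are zero. *)

(* Defs.v *)
From HB Require Import structures.
From mathcomp Require Import all_boot all_order all_algebra all_fingroup.
From mathcomp Require Import all_solvable all_field all_character.
From mathcomp Require Import finmap.
From mathcomp.multinomials Require Import monalg.
From mathcomp Require Import boolp reals.
From mathcomp Require Import complex.

Set Implicit Arguments.
Unset Strict Implicit.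
Unset Printing Implicit Defensive.

Import GRing.Theory.
Local Open Scope ring_scope.

(* C is an arbitrary numClosedFieldType throughout; it is meant to be R[i]    *)
(* for R : realType.                                                          *)

(* D_2n, for n >= 2: the pair (a, t) is r_n ^+ a * s_n ^+ t. See Grp_dih for  *)
(* the presentation.                                                          *)

Definition dih (n : nat) : Type := ('Z_n * bool)%type.

Section Dihedral.
Variable n : nat.

HB.instance Definition _ := Finite.on (dih n).

Definition dih_mul (x y : dih n) : dih n :=
  (x.1 + (if x.2 then - y.1 else y.1), x.2 (+) y.2).
Definition dih_one : dih n := (0, false).
Definition dih_inv (x : dih n) : dih n := (if x.2 then x.1 else - x.1, x.2).

Lemma dih_mulA : associative dih_mul.
Proof.
move=> [a [|]] [b [|]] [c [|]];
by rewrite /dih_mul /= ?opprD ?opprB ?opprK ?addrA.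
Qed.

Lemma dih_mul1 : left_id dih_one dih_mul.
Proof. by move=> [a s]; rewrite /dih_mul /= add0r. Qed.

Lemma dih_mulV : left_inverse dih_one dih_inv dih_mul.
Proof. by move=> [a [|]]; rewrite /dih_mul /= ?subrr ?addNr. Qed.

HB.instance Definition _ :=
  Finite_isGroup.Build (dih n) dih_mulA dih_mul1 dih_mulV.

Definition dih_r : dih n := (1, false).
Definition dih_s : dih n := (0, true).

Local Open Scope group_scope.

Lemma dihM (x y : dih n) :
  x * y = (x.1 + (if x.2 then - y.1 else y.1), x.2 (+) y.2)%R :> dih n.
Proof. by []. Qed.

Lemma dih_rX k : dih_r ^+ k = (k%:R%R, false) :> dih n.
Proof.
elim: k => [|k IHk]; first by rewrite expg0.
by rewrite expgS IHk dihM /= -natr1 addrC.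
Qed.

Lemma dihE (x : dih n) : x = dih_r ^+ x.1 * dih_s ^+ x.2.
Proof.
by case: x => a [|]; rewrite dih_rX /= ?expg1 ?mulg1 ?dihM /= ?addr0 natr_Zp.
Qed.

Lemma Grp_dih : (1 < n)%N ->
  [set: dih n] \isog Grp (x : y : x ^+ n, y ^+ 2, x ^ y = x^-1).
Proof.
move=> n_gt1; have Dn := Grp_dihedral n_gt1.
suffices isoD: [set: dih n] \isog [set: 'D_n.*2] by apply: isoGrp_trans Dn.
apply/(isoGrpP _ Dn); split.
  by rewrite card_dihedral // cardsT card_prod card_ord card_bool Zp_cast ?muln2.
apply/existsP; exists (dih_r, dih_s); rewrite /= !xpair_eqE /=; apply/and4P; split.
- rewrite eqEsubset subsetT; apply/subsetP=> x _; rewrite (dihE x) groupM //.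
    by apply: mem_gen; rewrite inE mem_cycle.
  by apply: mem_gen; rewrite inE mem_cycle orbT.
- by rewrite dih_rX; apply/eqP; congr (_, _); rewrite -Zp_nat_mod ?modnn.
- change (dih_s * dih_s == 1).
  by apply/eqP; rewrite dihM /= oppr0 addr0.
- change (dih_r ^ dih_s == dih_r^-1).
  rewrite eq_sym eq_invg_mul; apply/eqP; rewrite conjgE !dihM /=; congr (_, _) => /=.
  by rewrite addr0 add0r subrr.
Qed.

End Dihedral.

Section DihedralEmbedding.
Variables (p m n : nat).
Hypotheses (p_gt0 : (0 < p)%N) (m_gt1 : (1 < m)%N) (Dn : (p * m)%N = n).

(* r_m ^+ a * s_m ^+ b |-> r_n ^+ (p * a) * s_n ^+ b, where n = p * m. *)
Definition dih_emb (x : dih m) : dih n := ((p * x.1)%:R, x.2).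

Let n_gt1 : (1 < n)%N.
Proof. by rewrite -Dn (leq_trans m_gt1) ?leq_pmull. Qed.

Let emb_nat k : (p * (k%:R : 'Z_m))%:R = (p * k)%:R :> 'Z_n.
Proof.
apply: val_inj; rewrite /= !val_Zp_nat // -Dn muln_modr ?modn_mod //.
Qed.

Let embD (a b : 'Z_m) : (p * (a + b)%R)%:R = (p * a)%:R + (p * b)%:R :> 'Z_n.
Proof. by have := emb_nat (a + b)%N; rewrite natrD !natr_Zp mulnDr natrD. Qed.

Let embN (a : 'Z_m) : (p * (- a)%R)%:R = - (p * a)%:R :> 'Z_n.
Proof. by apply/eqP; rewrite -addr_eq0 -embD addNr muln0. Qed.

Lemma dih_embM : {in [set: dih m] &, {morph dih_emb : x y / (x * y)%g}}.
Proof.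
move=> [a s] [b t] _ _; rewrite /dih_emb !dihM /=; congr (_, _).
by case: s; rewrite embD // embN.
Qed.

Canonical dih_emb_morphism := Morphism dih_embM.

Lemma injm_dih_emb : ('injm dih_emb)%g.
Proof.
apply/injmP=> [[a s] [b t]] _ _ [eq_ab ->]; congr (_, _); apply: val_inj => /=.
have lt_m (c : 'Z_m) : (p * c < n)%N.
  by rewrite -Dn ltn_pmul2l // (leq_trans (ltn_ord c)) // Zp_cast.
move/(congr1 val): eq_ab; rewrite /= !val_Zp_nat // !modn_small //.
by move/eqP; rewrite eqn_pmul2l // => /eqP.
Qed.

End DihedralEmbedding.

(* An mx_representation is a left module by its action on column vectors. The *)
(* library's mx_irreducible and mx_rsim are stated for row vectors; over C,   *)
(* transposition shows that the two points of view have the same irreducible  *)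
(* representations, isomorphisms and multiplicities.                          *)

Section Restriction.
Variables (F : fieldType) (hT gT : finGroupType) (f : {morphism [set: hT] >-> gT}).
Variables (d : nat) (rG : mx_representation F [set: gT] d).

Lemma res_mx_repr : mx_repr [set: hT] (rG \o f).
Proof.
split=> [|x y _ _] /=; first by rewrite morph1 repr_mx1.
by rewrite morphM ?inE // repr_mxM ?inE.
Qed.
Definition res_repr := MxRepresentation res_mx_repr.
End Restriction.

Section Induction.
Variables (F : fieldType) (hT gT : finGroupType) (f : {morphism [set: hT] >-> gT}).
Hypothesis injf : ('injm f)%g.
Variables (d : nat) (rH : mx_representation F [set: hT] d).

Local Notation cosets := (lcosets (f @* [set: hT])%g [set: gT]).
Local Notation k := #|cosets|.

Definition ind_rep (i : 'I_k) : gT := repr (enum_val i : {set gT}).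

(* With t_i = ind_rep i, the induced module is the direct sum of the          *)
(* t_i (x) V, and g (t_j (x) v) = t_i (x) h v when g t_j = t_i f(h): the sum  *)
(* below has one term if such an h exists and is empty otherwise.             *)
Definition ind_block (g : gT) (i j : 'I_k) : 'M[F]_d :=
  \sum_(h : hT | f h == ((ind_rep i)^-1 * g * ind_rep j)%g) rH h.

Definition ind_mx (g : gT) : 'M[F]_(\sum_(i < k) d) :=
  \mxblock_(i < k, j < k) ind_block g i j.

Let K : {group gT} := (f @* [set: hT])%G.

Let ind_repK i : (ind_rep i *: K)%g = enum_val i.
Proof.
rewrite /ind_rep; have /lcosetsP[x _ xE] := enum_valP i; rewrite xE.
by have /lcoset_eqP-> := mem_repr x (lcoset_refl K x).
Qed.

Let ind_rep_inj i j : ((ind_rep i)^-1 * ind_rep j)%g \in K -> i = j.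
Proof.
rewrite -mem_lcoset => /lcoset_eqP eq_ij; apply: enum_val_inj.
by rewrite -!ind_repK eq_ij.
Qed.

Let ind_rep_ex (x : gT) : exists j, (x^-1 * ind_rep j)%g \in K.
Proof.
have xK : (x *: K)%g \in cosets by apply/lcosetsP; exists x; rewrite ?inE.
have [j jE] : exists j : 'I_k, enum_val j = (x *: K)%g.
  by exists (enum_rank_in xK (x *: K)%g); rewrite enum_rankK_in.
by exists j; rewrite -mem_lcoset -jE -ind_repK lcoset_refl.
Qed.

Let f_inj : injective f.
Proof. by move=> x y; apply: (injmP injf); rewrite inE. Qed.

Let f_K h : f h \in K.
Proof. by rewrite mem_morphim ?inE. Qed.

Let K_f x : x \in K -> exists h, x = f h.
Proof. by case/morphimP=> h _ _ ->; exists h. Qed.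

Let ind_block1 i j : ind_block 1 i j = (i == j)%:R%:M.
Proof.
rewrite /ind_block; have [<-|neq_ij] := eqVneq i j.
  rewrite (big_pred1 1%g) ?repr_mx1 // => h /=.
  by rewrite mulg1 mulVg -(morph1 f) (inj_eq f_inj).
rewrite big1 ?scalemx0 ?raddf0 // => h /eqP fh; case/eqP: neq_ij.
by apply: ind_rep_inj; rewrite -[X in (X * _)%g]mulg1 -fh f_K.
Qed.

Let ind_blockM x y i l :
  ind_block (x * y) i l = \sum_j (ind_block x i j *m ind_block y j l).
Proof.
transitivity (\sum_j \sum_(a | f a == ((ind_rep i)^-1 * x * ind_rep j)%g)
                 ind_block (x * y) i l); last first.
  apply: eq_bigr => j _; rewrite mulmx_suml; apply: eq_bigr => a /eqP fa.
  rewrite mulmx_sumr /ind_block (reindex_inj (mulgI a)) /=.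
  apply: eq_big => [b|b _]; last by rewrite repr_mxM ?inE.
  rewrite morphM ?inE // fa.
  rewrite -[RHS](inj_eq (mulgI ((ind_rep i)^-1 * x * ind_rep j)%g)).
  by congr (_ == _); rewrite !mulgA mulgK.
have [j ij] := ind_rep_ex (x^-1 * ind_rep i)%g.
have [a0 a0E] := K_f ij; rewrite invMg invgK in a0E.
rewrite (bigD1 j) //= (big_pred1 a0) => [|a]; last by rewrite a0E (inj_eq f_inj).
rewrite [X in _ + X]big1 ?addr0 // => j' /eqP neq_j'; rewrite big_pred0 // => a.
apply/eqP=> fa; case: neq_j'; apply: ind_rep_inj.
suff -> : ((ind_rep j')^-1 * ind_rep j)%g = f (a^-1 * a0)%g by [].
by rewrite morphM ?inE // morphV ?inE // fa -a0E !invMg !mulgA ?invgK mulgK mulgVK.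
Qed.

Lemma ind_mx_repr : mx_repr [set: gT] ind_mx.
Proof.
split=> [|x y _ _].
  rewrite -(mxdiagZ (p_ := fun=> d)); apply: eq_mxblock => i j.
  rewrite ind_block1; have [_|_] := eqVneq i j; first by rewrite conform_mx_id.
  by rewrite mulr0n raddf0.
rewrite /ind_mx mul_mxblock; apply: eq_mxblock => i l; exact: ind_blockM.
Qed.

Definition ind_repr := MxRepresentation ind_mx_repr.
End Induction.

Section LinearCombinations.
Variables (C : comNzRingType) (K : choiceType) (V : lmodType C).

Definition lincomb (f : K -> V) (c : {malg C[K]}) : V :=
  \sum_(k <- msupp c) c@_k *: f k.

Definition is_basis (f : K -> V) : Prop :=
  forall v : V, exists! c : {malg C[K]}, v = lincomb f c.

Lemma lincombEw f c (d : {fset K}) : (msupp c `<=` d)%fset ->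
  lincomb f c = \sum_(k <- d) c@_k *: f k.
Proof.
move=> le; rewrite [LHS](big_fset_incl _ le) => //= x xd /mcoeff_outdom ->.
by rewrite scale0r.
Qed.

Lemma lincomb_is_linear f : linear (lincomb f).
Proof.
move=> a c1 c2; set d := (msupp c1 `|` msupp c2 `|` msupp (a *: c1 + c2))%fset.
rewrite !(@lincombEw f _ d); first last.
- by rewrite fsubsetUr.
- by rewrite (fsubset_trans _ (fsubsetUl _ _)) ?fsubsetUl.
- by rewrite (fsubset_trans _ (fsubsetUl _ _)) ?fsubsetUr.
rewrite scaler_sumr -big_split /=; apply: eq_bigr => k _.
by rewrite mcoeffD mcoeffZ scalerDl scalerA.
Qed.
HB.instance Definition _ f :=
  GRing.isLinear.Build C {malg C[K]} V _ (lincomb f) (lincomb_is_linear f).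

Lemma lincombU f a k : lincomb f << a *g k >> = a *: f k.
Proof.
by rewrite (lincombEw _ (msuppU_le (k := k) (x := a))) big_seq_fset1 mcoeffUU.
Qed.

End LinearCombinations.

Definition primeT := {p : nat | prime p}.
Definition ge3 := {n : nat | (2 < n)%N}.

Section Groth.
Variable C : numClosedFieldType.

Definition dirr (n : nat) : irrType C [set: dih n] :=
  DecSocleType (regular_repr C [set: dih n]).

(* The isomorphism class (n, i), n >= 3, is that of irr_repr i.               *)
Definition simpleCls := {n : ge3 & dirr (val n)}.

Definition groth := {malg C[simpleCls]}.

Definition cls_simple (b : simpleCls) : groth := << b >>.

(* Every D_2n-module is the sum of its isotypic components W (Maschke), and   *)
(* irr_comp gives the class of the simple summands of W.                      *)
Definition mult (n : nat) d (rG : mx_representation C [set: dih n] d)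
    (i : dirr n) : nat :=
  \sum_(W : DecSocleType rG | irr_comp (dirr n) (socle_repr W) == i) socle_mult W.

Definition cls (n : ge3) d (rG : mx_representation C [set: dih (val n)] d) : groth :=
  \sum_(i : dirr (val n)) (mult rG i)%:R *: cls_simple (Tagged _ i).

Section Operators.
Variable p : primeT.

Lemma ge3_mul (n : ge3) : (2 < val p * val n)%N.
Proof. by rewrite (leq_trans (valP n)) // leq_pmull ?prime_gt0 // (valP p). Qed.
Definition mul_ge3 (n : ge3) : ge3 := Sub (val p * val n)%N (ge3_mul n).

Definition Ind_simple (b : simpleCls) : groth :=
  let: existT n i := b in
  cls (n := mul_ge3 n)
    (ind_repr (injm_dih_emb (prime_gt0 (valP p)) (ltnW (valP n)) erefl)
       (irr_repr i)).

(* The m >= 3 with n = p * m: there is at most one. *)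
Definition quo_ge3 (n : ge3) := {m : nat | (2 < m)%N && (val p * m == val n)%N}.

Definition quo_val (n : ge3) (m : quo_ge3 n) : ge3 :=
  Sub (val m) (proj1 (andP (valP m))).

Lemma quo_valE (n : ge3) (m : quo_ge3 n) : (val p * val (quo_val m))%N = val n.
Proof. by apply/eqP; case/andP: (valP m). Qed.

Definition Res_simple (b : simpleCls) : groth :=
  let: existT n i := b in
  match insub (val n %/ val p)%N : option (quo_ge3 n) with
  | Some m =>
      cls (n := quo_val m)
        (res_repr
           (dih_emb_morphism (prime_gt0 (valP p)) (ltnW (valP (quo_val m)))
              (quo_valE m))
           (irr_repr i))
  | None => 0
  end.

Definition Ind : groth -> groth := lincomb Ind_simple.
Definition Res : groth -> groth := lincomb Res_simple.
HB.instance Definition _ := GRing.Linear.on Ind.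
HB.instance Definition _ := GRing.Linear.on Res.
End Operators.

End Groth.

(* Quotients of algebras by two-sided ideals. The quotient may be 0, so in   *)
(* general it is only a pzRingType and an lmodType; the axioms relating the   *)
(* two structures are quot_scalerAl and quot_scalerAr.                        *)

HB.mixin Record isTwoSided (A : pzRingType) (I : A -> bool) := {
  idealMl : forall a x : A, x \in I -> a * x \in I;
  idealMr : forall a x : A, x \in I -> x * a \in I
}.

#[short(type="idealType")]
HB.structure Definition TwoSidedIdeal (A : pzRingType) :=
  {I of GRing.ZmodClosed A I & isTwoSided A I}.

Section QuotientAlgebra.
Variables (C : pzRingType) (A : algType C) (I : idealType A).

Definition quotalg : Type := (Quotient.quot I).
HB.instance Definition _ := GRing.Zmodule.on quotalg.

Definition qproj (x : A) : quotalg := \pi_(Quotient.quot I)%qT x.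

Lemma qprojP x y : qproj x = qproj y <-> x - y \in I.
Proof. by rewrite Quotient.idealrBE; split=> [/eqP|/eqP]. Qed.

Lemma qproj_is_zmod_morphism : zmod_morphism qproj.
Proof. exact: raddfB. Qed.
HB.instance Definition _ :=
  GRing.isZmodMorphism.Build A quotalg qproj qproj_is_zmod_morphism.

Local Notation qrepr u := (@generic_quotient.repr _ (Quotient.quot I) u).

Lemma qprojE (u : quotalg) : exists x, u = qproj x.
Proof. by exists (qrepr u); rewrite /qproj reprK. Qed.

Lemma qproj_reprB x : x - qrepr (qproj x) \in I.
Proof. by apply/qprojP; rewrite /qproj reprK. Qed.

Definition qmul (u v : quotalg) : quotalg := qproj (qrepr u * qrepr v).
Definition qscale (c : C) (u : quotalg) : quotalg := qproj (c *: qrepr u).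

Lemma qmulE x y : qmul (qproj x) (qproj y) = qproj (x * y).
Proof.
apply/esym/qprojP.
have -> : x * y - qrepr (qproj x) * qrepr (qproj y)
        = x * (y - qrepr (qproj y)) + (x - qrepr (qproj x)) * qrepr (qproj y).
  by rewrite mulrBr mulrBl addrA subrK.
by apply: rpredD; [apply: idealMl | apply: idealMr]; apply: qproj_reprB.
Qed.

Lemma qscaleE c x : qscale c (qproj x) = qproj (c *: x).
Proof.
apply/esym/qprojP; rewrite -scalerBr -[_ - _]mul1r scalerAl.
by rewrite idealMl ?qproj_reprB.
Qed.

Lemma qmulA : associative qmul.
Proof.
move=> u v w; have [x ->] := qprojE u; have [y ->] := qprojE v.
by have [z ->] := qprojE w; rewrite !qmulE mulrA.
Qed.

Lemma qmul1 : left_id (qproj 1) qmul.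
Proof. by move=> u; have [x ->] := qprojE u; rewrite qmulE mul1r. Qed.

Lemma qmulr1 : right_id (qproj 1) qmul.
Proof. by move=> u; have [x ->] := qprojE u; rewrite qmulE mulr1. Qed.

Lemma qmulDl : left_distributive qmul +%R.
Proof.
move=> u v w; have [x ->] := qprojE u; have [y ->] := qprojE v.
by have [z ->] := qprojE w; rewrite -raddfD !qmulE mulrDl raddfD.
Qed.

Lemma qmulDr : right_distributive qmul +%R.
Proof.
move=> u v w; have [x ->] := qprojE u; have [y ->] := qprojE v.
by have [z ->] := qprojE w; rewrite -raddfD !qmulE mulrDr raddfD.
Qed.

HB.instance Definition _ :=
  GRing.Zmodule_isPzRing.Build quotalg qmulA qmul1 qmulr1 qmulDl qmulDr.

Lemma qscaleA a b u : qscale a (qscale b u) = qscale (a * b) u.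
Proof. by have [x ->] := qprojE u; rewrite !qscaleE scalerA. Qed.

Lemma qscale1 : left_id 1 qscale.
Proof. by move=> u; have [x ->] := qprojE u; rewrite qscaleE scale1r. Qed.

Lemma qscaleDr : right_distributive qscale +%R.
Proof.
move=> a u v; have [x ->] := qprojE u; have [y ->] := qprojE v.
by rewrite -raddfD !qscaleE scalerDr raddfD.
Qed.

Lemma qscaleDl u : {morph qscale^~ u : a b / a + b}.
Proof. by move=> a b; have [x ->] := qprojE u; rewrite !qscaleE scalerDl raddfD. Qed.

HB.instance Definition _ :=
  GRing.Zmodule_isLmodule.Build C quotalg qscaleA qscale1 qscaleDr qscaleDl.

Lemma qproj_is_monoid_morphism : monoid_morphism qproj.
Proof. by split=> // x y; rewrite -qmulE. Qed.
HB.instance Definition _ :=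
  GRing.isMonoidMorphism.Build A quotalg qproj qproj_is_monoid_morphism.

Lemma qproj_is_scalable : scalable qproj.
Proof. by move=> c x; rewrite -qscaleE. Qed.
HB.instance Definition _ :=
  GRing.isScalable.Build C A quotalg *:%R qproj qproj_is_scalable.

Lemma qprojM x y : qproj x * qproj y = qproj (x * y).
Proof. exact: qmulE. Qed.

Lemma qprojZ c x : c *: qproj x = qproj (c *: x).
Proof. exact: qscaleE. Qed.

Lemma quot_scalerAl c (u v : quotalg) : c *: (u * v) = (c *: u) * v.
Proof.
have [x ->] := qprojE u; have [y ->] := qprojE v.
by rewrite qprojZ !qprojM qprojZ scalerAl.
Qed.

Lemma quot_scalerAr c (u v : quotalg) : c *: (u * v) = u * (c *: v).
Proof.
have [x ->] := qprojE u; have [y ->] := qprojE v.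
by rewrite qprojZ !qprojM qprojZ scalerAr.
Qed.

End QuotientAlgebra.

Section GeneratedIdeal.
Variables (A : pzRingType) (x : A).

Definition gen_ideal : {pred A} := fun y =>
  `[< exists s : seq (A * A), y = \sum_(ab <- s) ab.1 * x * ab.2 >].

Lemma gen_ideal_zmod_closed : zmod_closed gen_ideal.
Proof.
split; first by apply/asboolP; exists [::]; rewrite big_nil.
move=> _ _ /asboolP[s ->] /asboolP[t ->]; apply/asboolP.
exists (s ++ [seq (- ab.1, ab.2) | ab <- t]).
rewrite big_cat big_map /= -sumrN; congr (_ + _).
by apply: eq_bigr => ab _; rewrite !mulNr.
Qed.
HB.instance Definition _ := GRing.isZmodClosed.Build A gen_ideal
  gen_ideal_zmod_closed.

Lemma gen_idealMl a y : y \in gen_ideal -> a * y \in gen_ideal.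
Proof.
move=> /asboolP[s ->]; apply/asboolP; exists [seq (a * ab.1, ab.2) | ab <- s].
by rewrite big_map mulr_sumr; apply: eq_bigr => ab _; rewrite !mulrA.
Qed.

Lemma gen_idealMr a y : y \in gen_ideal -> y * a \in gen_ideal.
Proof.
move=> /asboolP[s ->]; apply/asboolP; exists [seq (ab.1, ab.2 * a) | ab <- s].
by rewrite big_map mulr_suml; apply: eq_bigr => ab _; rewrite !mulrA.
Qed.
HB.instance Definition _ :=
  isTwoSided.Build A gen_ideal gen_idealMl gen_idealMr.
End GeneratedIdeal.

Section LeftIdeal.
Variables (C : pzRingType) (A : algType C) (e : A).

Definition in_leftideal : {pred A} := fun x => `[< exists z, x = z * e >].

Lemma in_leftideal_submod_closed : submod_closed in_leftideal.
Proof.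
split; first by apply/asboolP; exists 0; rewrite mul0r.
move=> c _ _ /asboolP[x ->] /asboolP[y ->]; apply/asboolP; exists (c *: x + y).
by rewrite mulrDl scalerAl.
Qed.
HB.instance Definition _ := GRing.isSubmodClosed.Build C A in_leftideal
  in_leftideal_submod_closed.

Record leftideal := LeftIdeal {leftideal_val :> A; _ : leftideal_val \in in_leftideal}.
HB.instance Definition _ := [isSub for leftideal_val].
HB.instance Definition _ := [Choice of leftideal by <:].
HB.instance Definition _ := [SubChoice_isSubLmodule of leftideal by <:].

Lemma leftidealMl (a x : A) : x \in in_leftideal -> a * x \in in_leftideal.
Proof. by move=> /asboolP[z ->]; apply/asboolP; exists (a * z); rewrite mulrA. Qed.

Definition leftideal_mul (x y : leftideal) : leftideal :=
  LeftIdeal (leftidealMl (val x) (valP y)).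
End LeftIdeal.

Section FreeAlgebraAction.
Variables (C : numClosedFieldType) (P : {pred primeT}).

Definition primeIn := {p : primeT | p \in P}.

(* inl p is the symbol Res_p and inr p the symbol Ind_p. *)
Definition symb := (primeIn + primeIn)%type.

Definition freealg : Type := {malg C[{fmonom symb}]}.
HB.instance Definition _ := GRing.Lalgebra.on freealg.

Lemma freealg_scalerAr c (x y : freealg) : c *: (x * y) = x * (c *: y).
Proof.
apply/malgP=> k; rewrite mcoeffZ (mcoeffMlw (d1 := msupp x) (d2 := msupp y)) //.
rewrite (mcoeffMlw (d1 := msupp x) (d2 := msupp y)) ?msuppZ_le //.
rewrite mulr_sumr; apply: eq_bigr => i _; rewrite mulr_sumr; apply: eq_bigr => j _.
by rewrite mcoeffZ mulrnAr mulrCA.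
Qed.
HB.instance Definition _ :=
  GRing.Lalgebra_isAlgebra.Build C freealg freealg_scalerAr.

Definition ResA (p : primeIn) : freealg := << fmu (inl p : symb) >>.
Definition IndA (p : primeIn) : freealg := << fmu (inr p : symb) >>.

Definition symb_act (g : symb) : groth C -> groth C :=
  match g with inl p => @Res C (val p) | inr p => @Ind C (val p) end.

Definition word_act (w : {fmonom symb}) (v : groth C) : groth C :=
  foldr symb_act v w.

Definition free_act (a : freealg) (v : groth C) : groth C :=
  lincomb (word_act^~ v) a.

Lemma word_act_is_linear w : linear (word_act w).
Proof.
rewrite /word_act; elim: (w : seq symb) => //= -[p|p] s IHs c u v /=;
by rewrite IHs linearP.
Qed.
HB.instance Definition _ w :=
  GRing.isLinear.Build C (groth C) (groth C) _ (word_act w) (word_act_is_linear w).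

Lemma word_actM w1 w2 v :
  word_act (mmul w1 w2) v = word_act w1 (word_act w2 v).
Proof. by rewrite /word_act fmM foldr_cat. Qed.

Lemma act_is_linear a : linear (free_act a).
Proof.
move=> c u v; rewrite /free_act /lincomb scaler_sumr -big_split /=.
by apply: eq_bigr => w _; rewrite linearP scalerDr !scalerA mulrC.
Qed.
HB.instance Definition _ a :=
  GRing.isLinear.Build C (groth C) (groth C) _ (free_act a) (act_is_linear a).

Lemma actB a b v : free_act (a - b) v = free_act a v - free_act b v.
Proof. exact: raddfB. Qed.

Lemma act1 v : free_act 1 v = v.
Proof. by rewrite /free_act -[1]/(<< mone >> : freealg) lincombU scale1r /word_act fm1. Qed.

Lemma actM a b v : free_act (a * b) v = free_act a (free_act b v).
Proof.
rewrite /free_act malgME linear_sum [RHS]/lincomb; apply: eq_bigr => i _.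
rewrite !linear_sum /=; apply: eq_bigr => j _.
by rewrite lincombU word_actM linearZ scalerA.
Qed.

(* A nonzero submodule M of groth: submod_neq0 gives 1 != 0 in quotA below.   *)
Record nzsubmod := NzSubmod {
  submod_mem :> groth C -> Prop;
  submod0 : submod_mem 0;
  submodD : forall u v, submod_mem u -> submod_mem v -> submod_mem (u + v);
  submodA : forall a v, submod_mem v -> submod_mem (free_act a v);
  submod_neq0 : exists2 v, submod_mem v & v <> 0
}.

Section Annihilator.
Variable M : nzsubmod.

Definition Ann : {pred freealg} := fun a => `[< forall v, M v -> free_act a v = 0 >].

Lemma Ann_zmod_closed : zmod_closed Ann.
Proof.
split; first by apply/asboolP => v _; rewrite /free_act linear0.
move=> a b /asboolP a0 /asboolP b0; apply/asboolP => v Mv.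
by rewrite actB a0 ?b0 ?subrr.
Qed.
HB.instance Definition _ := GRing.isZmodClosed.Build freealg Ann Ann_zmod_closed.

Lemma AnnMl a b : b \in Ann -> a * b \in Ann.
Proof.
by move=> /asboolP b0; apply/asboolP => v Mv; rewrite actM b0 ?linear0.
Qed.

Lemma AnnMr a b : b \in Ann -> b * a \in Ann.
Proof.
by move=> /asboolP b0; apply/asboolP => v Mv; rewrite actM b0 //; apply: submodA.
Qed.
HB.instance Definition _ := isTwoSided.Build freealg Ann AnnMl AnnMr.

Definition quotA : Type := quotalg Ann.
HB.instance Definition _ := GRing.PzRing.on quotA.
HB.instance Definition _ := GRing.Lmodule.on quotA.

Lemma quotA_neq0 : (1 : quotA) != 0.
Proof.
apply/eqP=> one0; have {one0} : qproj Ann 1 = qproj Ann 0.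
  by rewrite raddf0; apply: one0.
rewrite qprojP subr0 => /asboolP one0; have [v Mv] := submod_neq0 M.
by apply; rewrite -[v]act1 one0.
Qed.
HB.instance Definition _ := GRing.PzSemiRing_isNonZero.Build quotA quotA_neq0.
HB.instance Definition _ := GRing.LSemiModule_isLSemiAlgebra.Build C quotA
  (@quot_scalerAl _ _ _).
HB.instance Definition _ := GRing.LSemiAlgebra_isSemiAlgebra.Build C quotA
  (@quot_scalerAr _ _ _).

Definition resQ (p : primeIn) : quotA := qproj Ann (ResA p).
Definition indQ (p : primeIn) : quotA := qproj Ann (IndA p).

Definition J1 (p : primeIn) : {pred quotA} :=
  gen_ideal (resQ p * indQ p - (val (val p))%:R).
Definition J2 (p : primeIn) : {pred quotA} :=
  gen_ideal (resQ p * indQ p - 1).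
HB.instance Definition _ p := TwoSidedIdeal.on (J1 p).
HB.instance Definition _ p := TwoSidedIdeal.on (J2 p).

Definition T1 (p : primeIn) := quotalg (J1 p).
Definition T2 (p : primeIn) := quotalg (J2 p).
Definition pi1 (p : primeIn) : quotA -> T1 p := qproj (J1 p).
Definition pi2 (p : primeIn) : quotA -> T2 p := qproj (J2 p).

Definition eps1 (q : primeIn) : quotA :=
  ((val (val q))%:R - 1 : C)^-1 *: (resQ q * indQ q - 1).
Definition eps2 (q : primeIn) : quotA :=
  ((val (val q))%:R - 1 : C)^-1 *: ((val (val q))%:R - resQ q * indQ q).

Definition expo : Type := {fsfun primeIn -> nat with 0%N}.
HB.instance Definition _ := Choice.on expo.

(* rk p = i means p = p_(i+1): an indexing of P is a bijection of P onto an   *)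
(* initial segment of nat, all of nat if P is infinite.                       *)
Definition indexing (rk : primeIn -> nat) : Prop :=
  injective rk /\ forall p i, (i < rk p)%N -> exists q, rk q = i.

(* The product of the x p ^+ k p, in increasing order of rk p.                *)
Definition ordprod (rk : primeIn -> nat) (x : primeIn -> quotA) (k : expo) : quotA :=
  \prod_(p <- sort (relpre rk leq) (finsupp k)) x p ^+ k p.

Definition monomial (rk : primeIn -> nat) (lk : expo * expo) : quotA :=
  ordprod rk indQ lk.1 * ordprod rk resQ lk.2.

End Annihilator.
End FreeAlgebraAction.

Arguments J1 {C P} M p.
Arguments J2 {C P} M p.
Arguments T1 {C P} M p.
Arguments T2 {C P} M p.
Arguments pi1 {C P} M p.
Arguments pi2 {C P} M p.
Arguments eps1 {C P} M q.
Arguments eps2 {C P} M q.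
Arguments monomial {C P} M rk lk.

Definition spanned_by (C : numClosedFieldType) (M B : _ -> Prop) : Prop :=
  forall v : groth C, M v <->
    exists s : seq (C * simpleCls C),
      (forall x, x \in s -> B x.2) /\ v = \sum_(x <- s) x.1 *: cls_simple x.2.

(* External direct sum; leftideal_mul2 is its componentwise product, where    *)
(* each left ideal carries the product of A.                                  *)
Definition leftideal2 (C : pzRingType) (A : algType C) (e1 e2 : A) : Type :=
  (leftideal e1 * leftideal e2)%type.
HB.instance Definition _ C A e1 e2 := GRing.Lmodule.on (@leftideal2 C A e1 e2).

Definition leftideal_mul2 (C : pzRingType) (A : algType C) (e1 e2 : A)
    (x y : leftideal2 e1 e2) : leftideal2 e1 e2 :=
  (leftideal_mul x.1 y.1, leftideal_mul x.2 y.2).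

(* Main.v *)
Require Import Defs.
From HB Require Import structures.
From mathcomp Require Import all_boot all_order all_algebra all_fingroup.
From mathcomp Require Import pgroup mxrepresentation finmap.
From mathcomp.multinomials Require Import monalg.
From mathcomp Require Import boolp reals complex.
Import Defs.

(** Everything is read off characters. For n odd, a class function on D_2n is
    an even function of the rotation angle together with one value on all the
    reflections. In these coordinates induction and restriction are explicit
    (chr_Res, chr_Ind_rot, chr_Ind_refl): restriction along D_2n in D_2pn
    samples the rotation function at the multiples of p and keeps the value on
    reflections; induction spreads it over those multiples with the factor p,
    and keeps the value on reflections. Hence Res_p Ind_p multiplies the
    rotation part by p and leaves the reflection part alone, so that
    (Res_p Ind_p - 1) / (p - 1) is the projection onto the rotation part,
    whatever p is. That projection commutes with all the operators, so eps1 and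
    eps2 are complementary central idempotents independent of q (eps1_indep,
    eps1_idem, eps1_central), and Res_p Ind_p - p and Res_p Ind_p - 1 are
    nonzero multiples of eps2 and eps1. The quotients by the ideals that these
    generate are therefore A eps1 and A eps2, which gives the direct sum
    decomposition and the independence of p.

    The same formulas show that Ind_p and Res_q commute with one another when
    p and q differ; this is where it matters that no n supporting M is a
    product of primes of P, for on the simple modules of D_2p the restriction
    Res_p is 0 whereas Res_p Ind_q need not be. With Res_p Ind_p = c_p a nonzero
    scalar in each quotient, the ordered monomials Ind^l Res^k span
    (mono_span). They are independent because each of the two parts of M
    contains a copy of one faithful module (mono_free). In the rotation part
    take half the character of the regular representation of D_2n, and in the
    reflection part half the difference of the trivial and the sign
    characters: either family X satisfies Ind_p X_n = X_(pn), and
    Res_p X_n = c_p X_(n/p) when p divides n and 0 otherwise, with c_p = p and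
    c_p = 1 respectively. Start from an n0 in the support of M prime to every
    p in P (a minimal one), and apply a relation to X_(n0 p^k) for a minimal
    exponent k that occurs in it: only the terms Ind^l Res^k survive, and they
    reach different vectors. *)

Set Implicit Arguments.
Unset Strict Implicit.
Unset Printing Implicit Defensive.
Import GRing.Theory Num.Theory.
Local Open Scope ring_scope.

(** * Traces of representations *)

Section Traces.
Variables (C : numClosedFieldType) (gT : finGroupType).
Local Notation G := [set: gT].
Variable sG : irrType C G.

Lemma pchar'_numField_group : ([pchar C]^'.-group G)%g.
Proof.
by apply: sub_pgroup (pgroup_pi _) => p _; apply/negP; rewrite pchar_num.
Qed.

(** By Maschke's theorem the socle is everything, and each of its components is
    a multiple of the irreducible representation selected by irr_comp. *)
Lemma mxtrace_irr_comp d (rG : mx_representation C G d) (g : gT) :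
  \tr (rG g) = \sum_(W : DecSocleType rG)
      (socle_mult W)%:R * \tr (irr_repr (irr_comp sG (socle_repr W)) g).
Proof.
have Gg : g \in G by rewrite inE.
have F'G := pchar'_numField_group.
have soc1 : (Socle (DecSocleType rG) :=: 1%:M)%MS.
  by rewrite reducible_Socle1 //; apply: mx_Maschke_pchar.
rewrite -(mxtrace_submod1 (Socle_module (DecSocleType rG)) soc1) // mxtrace_Socle //.
apply: eq_bigr => W _; rewrite mulr_natl; congr (_ *+ _).
apply: mxtrace_rsim => //; apply: rsim_irr_comp_pchar => //.
exact: socle_irr.
Qed.

(** The Wedderburn idempotent of i is a linear combination of group elements
    that acts as 1 on the representation i and as 0 on the others: its
    coefficients form a functional that separates i, so irreducible characters
    are linearly independent. *)
Lemma irr_trace_dual (i : sG) : exists e : gT -> C, forall j : sG,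
  \sum_g e g * \tr (irr_repr j g) = (irr_degree i)%:R *+ (i == j).
Proof.
have F'G := pchar'_numField_group.
have /envelop_mxP[e eE] : (Wedderburn_id i \in group_ring C G)%MS.
  by rewrite -(Wedderburn_sum_pchar sG) // (sumsmx_sup i) ?Wedderburn_id_mem.
exists e => j.
transitivity (\tr (gring_op (irr_repr j) (Wedderburn_id i))).
  rewrite eE !linear_sum /=; apply: eq_big => [g|g _]; first by rewrite inE.
  by rewrite !linearZ /= gring_opG ?inE.
have [<-|neq_ij] := eqVneq; first by rewrite op_Wedderburn_id_pchar // mxtrace1.
have -> : gring_op (irr_repr j) (Wedderburn_id i) = 0; last by rewrite mxtrace0.
by apply: irr_repr'_op0_pchar (Wedderburn_id_mem i).
Qed.

Lemma mxtrace_conj d (rG : mx_representation C G d) (g h : gT) :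
  \tr (rG (h^-1 * g * h)%g) = \tr (rG g).
Proof.
rewrite !repr_mxM ?inE // -mulmxA mxtrace_mulC -mulmxA -repr_mxM ?inE //.
by rewrite mulgV repr_mx1 mulmx1.
Qed.

Lemma mxtrace_regularE (g : gT) :
  \tr (regular_repr C G g) = #|gT|%:R *+ (g == 1%g).
Proof.
rewrite /mxtrace.
transitivity (\sum_(i < #|G|) (g == 1%g)%:R : C); last first.
  by rewrite sumr_const card_ord cardsT; case: eqP; rewrite ?mul0rn ?mulr1n.
apply: eq_bigr => i _; rewrite !mxE eqxx /=; congr (_ %:R); congr nat_of_bool.
rewrite -(inj_eq enum_val_inj) gring_indexK ?inE // -{1}[enum_val i]mulg1.
by rewrite (inj_eq (mulgI _)) eq_sym.
Qed.

End Traces.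

(** * Characters on the Grothendieck group *)

Lemma malg_lincomb (R : comNzRingType) (K : choiceType) (v : {malg R[K]}) :
  v = lincomb (fun k => << k >>) v.
Proof.
rewrite [LHS]monalgE; apply: eq_bigr => b _; apply/malgP => k.
by rewrite mcoeffZ !mcoeffU mulr_natr.
Qed.

(** The value at r_n^a s_n^t of the character of the class b, if b is a class of
    D_2n-modules. Indexing by natural numbers, with a taken modulo n, keeps
    the comparison of different dihedral groups free of casts. *)
Definition chr_simple (C : numClosedFieldType) (n a : nat) (t : bool) (b : simpleCls C) : C^o :=
  if val (tag b) == n then \tr (irr_repr (tagged b) (a%:R, t)) else 0.

Fact chr_key : unit. Proof. exact: tt. Qed.
(** Locked, so that values at different arguments are never compared by
    unfolding traces of representations. *)
Definition chr (C : numClosedFieldType) (n a : nat) (t : bool) (v : groth C) : C^o :=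
  locked_with chr_key (fun n a t => lincomb (chr_simple n a t)) n a t v.

Section Chr.
Variable C : numClosedFieldType.
Implicit Types (v : groth C) (b : simpleCls C).

Lemma chr_is_linear n a t : linear (@chr C n a t).
Proof. by rewrite /chr unlock; apply: lincomb_is_linear. Qed.
HB.instance Definition _ n a t :=
  GRing.isLinear.Build C (groth C) C^o _ (@chr C n a t) (chr_is_linear n a t).

Lemma chr_cls_simple n a t b : chr n a t (cls_simple b) = chr_simple n a t b.
Proof. by rewrite /chr unlock /cls_simple lincombU scale1r. Qed.

Lemma chrE n a t v : chr n a t v = \sum_(b <- msupp v) v@_b * chr_simple n a t b.
Proof. by rewrite /chr unlock. Qed.

Lemma chr_cls (m : ge3) d (rG : mx_representation C [set: dih (val m)] d) n a t :
  chr n a t (cls rG) = if val m == n then \tr (rG (a%:R, t)) else 0.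
Proof.
rewrite /cls linear_sum /=.
under eq_bigr => i _ do rewrite linearZ /= chr_cls_simple /chr_simple /=.
case: eqP => _; last by rewrite big1 // => i _; rewrite scaler0.
rewrite (mxtrace_irr_comp (dirr C (val m)) rG) /mult.
transitivity (\sum_(i : dirr C (val m))
    \sum_(W : DecSocleType rG | irr_comp (dirr C (val m)) (socle_repr W) == i)
      (socle_mult W)%:R * \tr (irr_repr i ((a%:R, t) : dih (val m)))).
  by apply: eq_bigr => i _; rewrite natr_sum scaler_suml.
rewrite (exchange_big_dep predT) //=; apply: eq_bigr => W _.
by rewrite (big_pred1 (irr_comp (dirr C (val m)) (socle_repr W))) // => i; rewrite eq_sym.
Qed.

Lemma chr_simple_dual b0 : exists (e : dih (val (tag b0)) -> C) (c : C), c != 0 /\ forall b,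
  \sum_g e g * chr_simple (val (tag b0)) (g.1 : 'Z__) g.2 b = c *+ (b == b0).
Proof.
case: b0 => n i /=; have [e eE] := irr_trace_dual i.
exists e, (irr_degree i)%:R; split; first by rewrite pnatr_eq0 -lt0n irr_degree_gt0.
case=> m j; rewrite /chr_simple /=; have [eq_mn|neq_mn] := eqVneq m n; last first.
  rewrite big1 => [|g _]; last by rewrite ifN ?mulr0 // (inj_eq val_inj).
  by case: eqP => // -[mn]; rewrite mn eqxx in neq_mn.
case: _ / eq_mn i e eE => i e eE; rewrite eqxx -tag_eqE /tag_eq /= eqxx tagged_asE eq_sym.
by rewrite -eE; apply: eq_bigr => -[a t] _; rewrite natr_Zp.
Qed.

(** Irreducible characters are linearly independent, so that characters
    determine the class. *)
Lemma chr_inj v : (forall n a t, chr n a t v = 0) -> v = 0.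
Proof.
move=> v0; apply/malgP => b0; rewrite mcoeff0.
have [e [c [c0 eE]]] := chr_simple_dual b0.
have: \sum_g e g * chr (val (tag b0)) (g.1 : 'Z__) g.2 v = v@_b0 * c.
  transitivity (\sum_(b <- msupp v) v@_b * (c *+ (b == b0))).
    under eq_bigr do rewrite chrE mulr_sumr.
    rewrite exchange_big /=; apply: eq_bigr => b _; rewrite -eE mulr_sumr.
    by apply: eq_bigr => g _; rewrite mulrCA.
  have [nv|nv] := boolP (b0 \in msupp v).
    rewrite (bigD1_seq _ nv) //= eqxx mulr1n big1 ?addr0 // => b /negPf->.
    by rewrite mulr0.
  rewrite (mcoeff_outdom nv) mul0r big1_seq // => b /=; case: eqP => [->|_ _].
    by rewrite (negPf nv).
  by rewrite mulr0.
rewrite big1 => [/esym/eqP|g _]; last by rewrite v0 mulr0.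
by rewrite mulf_eq0 (negPf c0) orbF => /eqP.
Qed.

Lemma chr_ext v w : (forall n a t, chr n a t v = chr n a t w) -> v = w.
Proof.
move=> eq_vw; apply/eqP; rewrite -subr_eq0; apply/eqP/chr_inj => n a t.
by rewrite linearB /= eq_vw subrr.
Qed.

End Chr.

(** * Restriction and induction of characters of dihedral groups *)

Section IndTrace.
Variables (F : fieldType) (hT gT : finGroupType) (f : {morphism [set: hT] >-> gT}).
Hypothesis injf : ('injm f)%g.
Variables (d : nat) (rH : mx_representation F [set: hT] d).
Local Notation K := (f @* [set: hT])%g.

Lemma mxtrace_ind (g : gT) : \tr (ind_repr injf rH g) =
  \sum_(i < #|lcosets K [set: gT]|)
     \sum_(h | f h == ((ind_rep i)^-1 * g * ind_rep i)%g) \tr (rH h).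
Proof. by rewrite mxtrace_mxblock; apply: eq_bigr => i _; rewrite raddf_sum. Qed.

Lemma sum_fiber_injm (V : nmodType) (E : hT -> V) h0 :
  \sum_(h | f h == f h0) E h = E h0.
Proof.
by rewrite (big_pred1 h0) // => h /=; rewrite (inj_in_eq (injmP injf)) ?inE.
Qed.

Lemma sum_fiber_notin (V : nmodType) (E : hT -> V) x : x \notin K ->
  \sum_(h | f h == x) E h = 0.
Proof.
by move=> xK; rewrite big_pred0 // => h; apply: contraNF xK => /eqP<-; rewrite mem_morphim ?inE.
Qed.

Lemma ind_rep_coset (x : gT) (i : 'I_#|lcosets K [set: gT]|) :
  ((x^-1 * ind_rep i)%g \in K) = (enum_val i == x *: K)%g.
Proof.
rewrite -mem_lcoset /ind_rep; have /lcosetsP[y _ ->] := enum_valP i.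
have /lcoset_eqP ry := mem_repr y (lcoset_refl (f @* [set: hT])%G y).
by apply/lcoset_eqP/eqP => [xr|<-//]; rewrite -ry.
Qed.

End IndTrace.

Lemma dih_conj_rot n (a : 'Z_n) (c : dih n) :
  (c^-1 * ((a, false) : dih n) * c)%g = (if c.2 then - a else a, false).
Proof.
case: c => c [] ; rewrite !dihM /=; congr (_, _) => /=.
  by rewrite addrAC subrr add0r.
by rewrite addrAC addNr add0r.
Qed.

Lemma card_dih n : (1 < n)%N -> #|[set: dih n]| = (2 * n)%N.
Proof. by move=> n1; rewrite cardsT card_prod card_ord card_bool Zp_cast // mulnC. Qed.

(** As n is odd, (n + 1) / 2 is an inverse of 2 modulo n. *)
Lemma halfZp n (c : 'Z_n) : odd n -> (1 < n)%N -> c = c *+ uphalf n + c *+ uphalf n.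
Proof.
move=> n_odd n_gt1.
have uE : (uphalf n + uphalf n)%N = n.+1.
  by rewrite addnn uphalf_half n_odd doubleD -[in RHS](odd_double_half n) n_odd.
rewrite -mulrnDr uE.
by rewrite mulrS -mulr_natr pchar_Zp // mulr0 addr0.
Qed.

(** The reflection r^c s is the conjugate of s by r^(c/2). *)
Lemma mxtrace_dih_refl (C : numClosedFieldType) n d
    (rG : mx_representation C [set: dih n] d) (c : 'Z_n) :
  odd n -> (1 < n)%N -> \tr (rG (c, true)) = \tr (rG (dih_s n)).
Proof.
move=> n_odd n_gt1.
rewrite -(mxtrace_conj rG (dih_s n) ((c *- uphalf n, false) : dih n)).
congr (\tr (rG _)); rewrite !dihM /=; congr (_, _).
by rewrite opprK addr0 -halfZp.
Qed.

Section DihTrace.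
Variables (p m n : nat).
Hypotheses (p_gt0 : (0 < p)%N) (m_gt1 : (1 < m)%N) (Dn : (p * m)%N = n).

Let n_gt1 : (1 < n)%N.
Proof. by rewrite -Dn (leq_trans m_gt1) ?leq_pmull. Qed.

Local Notation emb := (dih_emb_morphism p_gt0 m_gt1 Dn).
Local Notation K := (emb @* [set: dih m])%g.

Lemma dih_emb_nat k t : emb (k%:R, t) = ((p * k)%:R, t).
Proof.
congr (_, _); apply: val_inj; rewrite /= !val_Zp_nat // -Dn.
by rewrite muln_modr modn_mod.
Qed.

Lemma mem_dih_emb k t : (((k%:R, t) : dih n) \in K) = (p %| k)%N.
Proof.
have p_n : (p %| n)%N by rewrite -Dn dvdn_mulr.
apply/morphimP/idP => [[[a u] _ _]|/dvdnP[q ->]]; last first.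
  by exists (q%:R, t); rewrite ?inE // dih_emb_nat mulnC.
rewrite /= /dih_emb => -[+ _] => /(congr1 val); rewrite /= !val_Zp_nat // => ka.
rewrite (divn_eq k n) ka dvdn_add ?(dvdn_mull _ p_n) //.
by rewrite -Dn -muln_modr dvdn_mulr.
Qed.

Lemma dih_emb_s_mem t : ((0, t) : dih n) \in K.
Proof. by rewrite -[0]/(0%:R) mem_dih_emb. Qed.

(** The image contains s, so membership only depends on the rotation part. *)
Lemma dih_emb_memE (x : dih n) : (x \in K) = (((x.1, false) : dih n) \in K).
Proof.
have -> : x = (((x.1, false) : dih n) * ((0, x.2) : dih n))%g.
  by case: x => a t; rewrite dihM /= addr0.
by rewrite groupMr ?dih_emb_s_mem // dihM /= addr0.
Qed.

Lemma card_dih_cosets : #|lcosets K [set: dih n]| = p.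
Proof.
rewrite card_lcosets -divgS ?subsetT // card_injm ?injm_dih_emb //.
by rewrite !card_dih // -Dn mulnCA mulnK // muln_gt0 (ltnW m_gt1).
Qed.

Variables (C : numClosedFieldType) (d : nat).
Variable rH : mx_representation C [set: dih m] d.
Local Notation ind := (ind_repr (injm_dih_emb p_gt0 m_gt1 Dn) rH).

(** Conjugation by any coset representative sends a rotation to itself or to its
    inverse, so each of the p cosets contributes the same amount. *)
Lemma mxtrace_ind_rot k : \tr (ind (k%:R, false)) =
  if (p %| k)%N then p%:R * \tr (rH ((k %/ p)%:R, false)) else 0.
Proof.
rewrite mxtrace_ind.
pose z : C := if (p %| k)%N then \tr (rH ((k %/ p)%:R, false)) else 0.
transitivity (\sum_(i < #|lcosets K [set: dih n]|) z); last first.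
  rewrite sumr_const cardT size_enum_ord card_dih_cosets /z.
  by case: ifP => _; rewrite ?mul0rn ?mulr_natl.
apply: eq_bigr => i _; rewrite dih_conj_rot /z; have [/dvdnP[q ->]|pk] := boolP (p %| k)%N.
  rewrite mulnK //; case: (ind_rep i).2; last first.
    by rewrite mulnC -dih_emb_nat sum_fiber_injm ?injm_dih_emb.
  have -> : (- (q * p)%:R, false) = emb ((q%:R, false) : dih m)^-1%g.
    by rewrite morphV ?inE // dih_emb_nat mulnC.
  rewrite sum_fiber_injm ?injm_dih_emb // -(mxtrace_conj _ _ (dih_s m)).
  by congr (\tr (rH _)); rewrite dih_conj_rot /= opprK.
rewrite sum_fiber_notin //; apply: contra pk; rewrite -(mem_dih_emb k false).
case: (ind_rep i).2 => // /groupVr.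
by rewrite -[(_^-1)%g]/((- - _, false) : dih n) opprK.
Qed.

Hypothesis n_odd : odd n.

(** If y has rotation part c, the conjugate of s by y has rotation part 2c or
    -2c, and 2 is invertible modulo n: only the elements of the image conjugate
    s into the image. *)
Lemma dih_conj_s_mem (y : dih n) : ((y^-1 * dih_s n * y)%g \in K) = (y \in K).
Proof.
apply/idP/idP => [|Ky]; last by rewrite !groupM ?groupV ?dih_emb_s_mem.
rewrite (dih_emb_memE (_ * y)%g) (dih_emb_memE y); case: y => c u.
have -> : (((c, u) : dih n)^-1 * dih_s n * ((c, u) : dih n))%g.1 = if u then c + c else - (c + c).
  by rewrite !dihM; case: u => /=; rewrite ?addr0 ?oppr0 ?opprK ?opprD ?addr0.
move=> cK; have {}cK : ((c + c, false) : dih n) \in K.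
  by case: u cK => // /groupVr; rewrite -[(_^-1)%g]/((- - _, false) : dih n) opprK.
have -> : ((c, u) : dih n).1 = (c + c) *+ uphalf n.
  by rewrite /= mulrnDl -halfZp.
elim: (uphalf n) => [|k IHk]; first exact: dih_emb_s_mem.
rewrite mulrS -[X in X \in _]/(((c + c, false) : dih n) *
  (((c + c) *+ k, false) : dih n))%g.
by rewrite groupM.
Qed.

(** The reflection is the conjugate of s by x, the rotation of half the angle;
    by the previous lemma only the coset of x contributes. *)
Lemma mxtrace_ind_refl (a : 'Z_n) : \tr (ind (a, true)) = \tr (rH (dih_s m)).
Proof.
rewrite mxtrace_ind; pose x : dih n := (a *+ uphalf n, false).
have -> : (a, true) = (x * dih_s n * x^-1)%g.
  by rewrite !dihM /=; congr (_, _); rewrite addr0 opprK; apply: halfZp.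
have xK : (x *: K)%g \in lcosets K [set: dih n] by apply/lcosetsP; exists x; rewrite ?inE.
have conjE (t : dih n) : (t^-1 * (x * dih_s n * x^-1) * t)%g
    = ((x^-1 * t)^-1 * dih_s n * (x^-1 * t))%g.
  by rewrite invMg invgK !mulgA.
pose term (i : 'I_#|lcosets K [set: dih n]|) :=
  \sum_(h | emb h == ((ind_rep i)^-1 * (x * dih_s n * x^-1) * ind_rep i)%g)
     \tr (rH h).
rewrite (bigD1 (enum_rank_in xK (x *: K)%g)) // (@big1 _ _ _ _ _ _ term) => [|i /= neq_i].
  rewrite Monoid.mulm1.
  rewrite conjE; set y := (x^-1 * _)%g.
  have: (y^-1 * dih_s n * y)%g \in K.
    by rewrite dih_conj_s_mem ind_rep_coset enum_rankK_in.
  case/morphimP => -[b u] _ _ E; rewrite E sum_fiber_injm ?injm_dih_emb //.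
  suff -> : u = true.
    by apply: mxtrace_dih_refl => //; move: n_odd; rewrite -Dn oddM => /andP[].
  by move/(congr1 snd): E; case: (y) => c [].
rewrite /term conjE sum_fiber_notin // dih_conj_s_mem ind_rep_coset.
apply: contra neq_i => /eqP xi; apply/eqP/enum_val_inj.
by rewrite enum_rankK_in.
Qed.

End DihTrace.

Section ChrOperators.
Variable C : numClosedFieldType.
Implicit Types (v : groth C) (b : simpleCls C).

(** There are no dihedral groups of order less than 6 in the Grothendieck
    group. *)
Lemma chr_small n a t v : (n <= 2)%N -> chr n a t v = 0.
Proof.
move=> n_le2; rewrite chrE big1 // => b _; rewrite /chr_simple ifN ?mulr0 //.
by apply: contraTneq n_le2 => <-; rewrite -ltnNge; apply: valP (tag b).
Qed.

Lemma chr_Res (p : primeT) n a t v : chr n a t (Res p v) =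
  if (2 < n)%N then chr (val p * n) (val p * a) t v else 0.
Proof.
case: ifPn => [n_gt2|]; last by rewrite -leqNgt; apply: chr_small.
rewrite /Res /lincomb linear_sum [RHS]chrE; apply: eq_bigr => -[k i] _ /=.
rewrite linearZ /=; congr (_ * _); rewrite /chr_simple /=.
have p_gt0 := prime_gt0 (valP p).
case: insubP => [m /andP[m_gt2 /eqP km] mE|knm]; last first.
  rewrite linear0 ifN //; apply: contra knm => /eqP->.
  by rewrite mulKn // n_gt2 eqxx.
rewrite chr_cls /=.
have -> : (val k == val p * n)%N = (val m == n) by rewrite mE -[RHS](eqn_pmul2l p_gt0) km.
case: (val m == n); last by [].
by rewrite -(dih_emb_nat p_gt0 (ltnW (valP (quo_val m))) (quo_valE m)).
Qed.

Lemma chr_Ind_rot (p : primeT) n a v : chr n a false (Ind p v) =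
  if (val p %| n)%N && (val p %| a)%N then
    (val p)%:R * chr (n %/ val p) (a %/ val p) false v else 0.
Proof.
have p_gt0 := prime_gt0 (valP p).
transitivity (\sum_(b <- msupp v) v@_b *
  if (val p %| n)%N && (val p %| a)%N then
    (val p)%:R * chr_simple (n %/ val p) (a %/ val p) false b else 0).
  rewrite /Ind /lincomb linear_sum; apply: eq_bigr => -[m i] _ /=.
  rewrite linearZ /=; congr (_ * _); rewrite chr_cls /chr_simple /=.
  case: eqP => [<-|pmn].
    by rewrite dvdn_mulr //= mulKn // eqxx mxtrace_ind_rot.
  case: ifP => // /andP[/dvdnP[k nE] _]; rewrite nE mulnK // ifN ?mulr0 //.
  by apply/eqP=> mk; apply: pmn; rewrite nE mk mulnC.
case: ifP => _; last by rewrite big1 // => b _; rewrite mulr0.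
by rewrite chrE mulr_sumr; apply: eq_bigr => b _; rewrite mulrCA.
Qed.

Lemma chr_Ind_refl (p : primeT) n a v : odd n -> chr n a true (Ind p v) =
  if (val p %| n)%N then chr (n %/ val p) 0 true v else 0.
Proof.
move=> n_odd; have p_gt0 := prime_gt0 (valP p).
transitivity (\sum_(b <- msupp v) v@_b *
  if (val p %| n)%N then chr_simple (n %/ val p) 0 true b else 0).
  rewrite /Ind /lincomb linear_sum; apply: eq_bigr => -[m i] _ /=.
  rewrite linearZ /=; congr (_ * _); rewrite chr_cls /chr_simple /=.
  case: eqP => [nE|pmn].
    rewrite -nE dvdn_mulr //= mulKn // eqxx mxtrace_ind_refl //.
    by rewrite nE.
  case: ifP => // /dvdnP[k nE]; rewrite nE mulnK // ifN //.
  by apply/eqP=> mk; apply: pmn; rewrite nE mk mulnC.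
by case: ifP => _; rewrite ?chrE // big1 // => b _; rewrite mulr0.
Qed.

Lemma chr_simple_refl n a b : odd n ->
  chr_simple n a true b = chr_simple n 0 true b.
Proof.
move=> n_odd; rewrite /chr_simple; case: eqP => [bn|_]; last by [].
have reflE c : \tr (irr_repr (tagged b) (c, true)) = \tr (irr_repr (tagged b) (dih_s _)).
  by apply: mxtrace_dih_refl; [rewrite bn | apply: ltnW (valP (tag b))].
exact: etrans (reflE _) (esym (reflE _)).
Qed.

Lemma chr_refl n a v : odd n -> chr n a true v = chr n 0 true v.
Proof.
move=> n_odd; rewrite chrE [RHS]chrE; apply: eq_bigr => b _.
by rewrite (chr_simple_refl a).
Qed.

End ChrOperators.

(** * The faithful action of the quotient algebra *)

Section QuotientAction.
Variables (C : numClosedFieldType) (P : {pred primeT}) (M : nzsubmod C P).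
Implicit Types (v w : groth C) (z : quotA M) (p q : primeIn P).

(** The quotient acts on M through representatives; outside M the value depends
    on the representative chosen. *)
Definition qact z v : groth C := free_act (generic_quotient.repr z : freealg C P) v.

Lemma qactE a v : M v -> qact (qproj (Ann M) a) v = free_act a v.
Proof.
move=> Mv; have /asboolP/(_ v Mv) := qproj_reprB (Ann M) a.
by rewrite actB => /eqP; rewrite subr_eq0 => /eqP ->.
Qed.

Lemma qact_is_linear z : linear (qact z).
Proof. exact: act_is_linear. Qed.
HB.instance Definition _ z :=
  GRing.isLinear.Build C (groth C) (groth C) _ (qact z) (qact_is_linear z).

Lemma qact_mem z v : M v -> M (qact z v).
Proof. exact: submodA. Qed.

Lemma submodZ c v : M v -> M (c *: v).
Proof.
move=> Mv; suff -> : c *: v = free_act (c *: 1 : freealg C P) v by apply: submodA.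
rewrite /free_act linearZ /=; congr (_ *: _).
exact: esym (act1 P v).
Qed.

Lemma qactD z1 z2 v : M v -> qact (z1 + z2) v = qact z1 v + qact z2 v.
Proof.
move=> Mv; have [a1 ->] := qprojE z1; have [a2 ->] := qprojE z2.
rewrite -[qproj _ a1 + _]raddfD !qactE //; exact: linearD.
Qed.

Lemma qactZ c z v : M v -> qact (c *: z) v = c *: qact z v.
Proof.
move=> Mv; have [a ->] := qprojE z.
rewrite -[c *: _]linearZ !qactE //; exact: linearZ.
Qed.

Lemma qactMul z1 z2 v : M v -> qact (z1 * z2) v = qact z1 (qact z2 v).
Proof.
move=> Mv; have [a1 ->] := qprojE z1; have [a2 ->] := qprojE z2.
have -> : (qproj (Ann M) a1 : quotA M) * qproj (Ann M) a2 = qproj (Ann M) (a1 * a2).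
  exact: qprojM.
rewrite (qactE (a1 * a2) Mv) (qactE a2 Mv) (qactE a1 (submodA a2 Mv)).
exact: actM.
Qed.

Lemma qact1 v : M v -> qact 1 v = v.
Proof. by move=> Mv; rewrite -[1]/(qproj (Ann M) 1) qactE // act1. Qed.

Lemma qact0 v : M v -> qact 0 v = 0.
Proof. by move=> Mv; rewrite -[0](scale0r (1 : quotA M)) qactZ // scale0r. Qed.

Lemma qactB z1 z2 v : M v -> qact (z1 - z2) v = qact z1 v - qact z2 v.
Proof. by move=> Mv; rewrite -scaleN1r qactD // qactZ // scaleN1r. Qed.

(** The annihilator has been divided out, so the action is faithful. *)
Lemma qact_inj z1 z2 : (forall v, M v -> qact z1 v = qact z2 v) -> z1 = z2.
Proof.
have [a1 ->] := qprojE z1; have [a2 ->] := qprojE z2 => eq_act.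
apply/qprojP/asboolP => v Mv; rewrite actB -!qactE // eq_act //.
exact: subrr.
Qed.

Lemma qact_res p v : M v -> qact (resQ M p) v = Res (val p) v.
Proof.
by move=> Mv; rewrite qactE // /free_act lincombU scale1r /word_act fmU.
Qed.

Lemma qact_ind p v : M v -> qact (indQ M p) v = Ind (val p) v.
Proof.
by move=> Mv; rewrite qactE // /free_act lincombU scale1r /word_act fmU.
Qed.

Lemma Res_mem p v : M v -> M (Res (val p) v).
Proof. by move=> Mv; rewrite -qact_res //; apply: qact_mem. Qed.

Lemma Ind_mem p v : M v -> M (Ind (val p) v).
Proof. by move=> Mv; rewrite -qact_ind //; apply: qact_mem. Qed.

(** Induction on words in the symbols. *)
Lemma quotA_ind (Q : quotA M -> Prop) : Q 1 ->
  (forall c z1 z2, Q z1 -> Q z2 -> Q (c *: z1 + z2)) ->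
  (forall p z, Q z -> Q (resQ M p * z)) ->
  (forall p z, Q z -> Q (indQ M p * z)) ->
  forall z, Q z.
Proof.
move=> Q1 Qlin Qres Qind z; have [a ->] := qprojE z.
have Q0 : Q 0 by have := Qlin (-1) 1 1 Q1 Q1; rewrite scaleN1r addNr.
have Qword (w : {fmonom symb P}) : Q (qproj (Ann M) (<< w >> : freealg C P)).
  case: w => s; elim: s => [|g s IHs].
    have -> : FMonom [::] = mone :> {fmonom symb P} by apply: val_inj; rewrite /= fm1.
    exact: Q1.
  have -> : (<< FMonom (g :: s) >> : freealg C P) = << fmu g >> * << FMonom s >>.
    rewrite [RHS]malgM_def fgmulUU mulr1; congr << _ >>.
    by apply: val_inj; rewrite /= fmM fmU.
  rewrite rmorphM /=; case: g => p; [exact: Qres|exact: Qind].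
rewrite (malg_lincomb a) /lincomb raddf_sum.
elim/big_rec: _ => // w u _ Qu.
have := Qlin a@_w _ _ (Qword w) Qu.
suff <- : qproj (Ann M) (a@_w *: (<< w >> : freealg C P)) =
  a@_w *: (qproj (Ann M) (<< w >> : freealg C P) : quotA M) by [].
exact: linearZ.
Qed.

End QuotientAction.

(** * Commutation relations from character formulas *)

(** The value of a class function on a reflection does not depend on the
    rotation part, which is normalised to 0. *)
Definition rotdiv (t : bool) a d : nat := if t then 0 else (a %/ d)%N.

(** The commutation relations only involve character formulas; V stands for the
    Grothendieck group, M for the submodule and d p for the prime p. *)
Section CharacterModel.
Variables (C : comNzRingType) (I : eqType) (d : I -> nat) (V : Type) (M : V -> Prop).
Variables (ch : nat -> nat -> bool -> V -> C) (res ind : I -> V -> V).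
Hypothesis d_gt0 : forall p, (0 < d p)%N.
Hypothesis d_coprime : forall p q, p != q -> coprime (d p) (d q).
Hypothesis res_mem : forall p v, M v -> M (res p v).
Hypothesis ind_mem : forall p v, M v -> M (ind p v).
Hypothesis ch_ext : forall v w, (forall n a t, ch n a t v = ch n a t w) -> v = w.
Hypothesis ch_refl : forall v n a, M v -> ch n a true v = ch n 0 true v.
Hypothesis ch_res : forall p v n a t, M v -> ch n a t (res p v) = ch (d p * n) (d p * a) t v.

Definition weight (t : bool) p : C := if t then 1 else (d p)%:R.

Hypothesis ch_ind : forall p v n a t, M v -> ch n a t (ind p v) =
  if (d p %| n)%N && (t || (d p %| a)%N) then
    weight t p * ch (n %/ d p) (rotdiv t a (d p)) t v else 0.

(** The eigenvalues of Res_p Ind_p: p on the rotation part and 1 on the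
    reflection part. *)
Lemma ch_res_ind p v n a t : M v ->
  ch n a t (res p (ind p v)) = weight t p * ch n a t v.
Proof.
move=> Mv; rewrite ch_res; last exact: ind_mem.
rewrite ch_ind // !dvdn_mulr // orbT mulKn // /rotdiv.
by case: t; rewrite ?mulKn // [in RHS]ch_refl.
Qed.

Lemma resC p q v : M v -> res p (res q v) = res q (res p v).
Proof.
move=> Mv; apply: ch_ext => n a t.
rewrite !ch_res //; try exact: res_mem.
by rewrite !mulnA [(d q * d p)%N]mulnC.
Qed.

Lemma indC p q v : M v -> ind p (ind q v) = ind q (ind p v).
Proof.
move=> Mv; apply: ch_ext => n a t.
have ind2 p1 p2 : ch n a t (ind p1 (ind p2 v)) =
    if (d p1 * d p2 %| n)%N && (t || (d p1 * d p2 %| a)%N) then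
      weight t p1 * weight t p2 *
        ch (n %/ (d p1 * d p2)) (rotdiv t a (d p1 * d p2)) t v else 0.
  rewrite ch_ind; last exact: ind_mem.
  have dvdM k : (d p1 * d p2 %| k)%N = (d p1 %| k)%N && (d p2 %| k %/ d p1)%N.
    case: (boolP (d p1 %| k)%N) => pk /=; first by rewrite dvdn_divRL // mulnC.
    by apply: contraNF pk; apply: dvdn_trans (dvdn_mulr _ _).
  rewrite !dvdM ch_ind // /rotdiv divnMA.
  case: (d p1 %| n)%N => //=; case: t => /=.
    by rewrite !andbT; case: ifP; rewrite ?mulr0 ?mulrA.
  case: (d p1 %| a)%N; rewrite /= ?andbF //.
  by case: ifP; rewrite ?mulr0 ?mulrA // divnMA.
by rewrite !ind2 [(d q * d p)%N]mulnC [weight t q * _]mulrC.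
Qed.

Lemma res_ind_neq p q v : M v -> p != q -> res p (ind q v) = ind q (res p v).
Proof.
move=> Mv neq_pq; apply: ch_ext => n a t.
rewrite ch_res; last exact: ind_mem.
rewrite !ch_ind //; last exact: res_mem.
have co : coprime (d q) (d p) by rewrite d_coprime // eq_sym.
rewrite !Gauss_dvdr //; case: ifP => // /andP[qn qa].
rewrite ch_res // muln_divA //; congr (_ * ch _ _ _ _); rewrite /rotdiv.
by case: t qa => [_|/= qa]; rewrite ?muln0 // muln_divA.
Qed.

End CharacterModel.

(** The n that may occur in the support of M. *)
Definition outside (P : {pred primeT}) (n : nat) : Prop :=
  odd n /\ ~ (forall p : primeT, (val p %| n)%N -> p \in P).

(** A nonzero character value at n comes from a basis element of M at n. *)
Lemma chr_outside (C : numClosedFieldType) (P : {pred primeT}) (M : nzsubmod C P)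
    (M_span : exists B : simpleCls C -> Prop,
        (forall b, B b -> odd (val (tag b))) /\ spanned_by M B)
    (M_not_P : forall b : simpleCls C, M (cls_simple b) ->
        ~ (forall p : primeT, (val p %| val (tag b))%N -> p \in P)) v n a t :
  M v -> chr n a t v <> 0 ->
  exists b, [/\ val (tag b) = n, M (cls_simple b) & outside P n].
Proof.
case: M_span => B [B_odd M_B] Mv chr_v.
have /M_B[s [Bs vE]] := Mv.
have [x xs xn] : exists2 x, x \in s & val (tag x.2) = n.
  apply: contrapT => no_x; apply: chr_v; rewrite vE linear_sum big1_seq // => x /= xs.
  rewrite linearZ /= chr_cls_simple /chr_simple ifN ?scaler0 //.
  by apply/eqP => xn; apply: no_x; exists x.
have Mx : M (cls_simple x.2).
  apply/M_B; exists [:: (1, x.2)]; split; last by rewrite big_seq1 scale1r.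
  by move=> y; rewrite inE => /eqP->; apply: Bs xs.
by exists x.2; split=> //; split; rewrite -xn; [apply/B_odd/Bs | apply: M_not_P].
Qed.

Definition prime_val (P : {pred primeT}) (p : primeIn P) : nat := val (val p).

Section Relations.
Variables (C : numClosedFieldType) (P : {pred primeT}) (M : nzsubmod C P).
Hypothesis P_odd : forall p, p \in P -> odd (val p).
Hypothesis M_chr : forall v n a t, M v -> chr n a t v <> 0 -> outside P n.
Implicit Types (v w : groth C) (z : quotA M) (p q : primeIn P).

Local Notation vp := (@prime_val P).
Let vp_gt0 p : (0 < vp p)%N. Proof. exact: prime_gt0 (valP (val p)). Qed.
Let vp_odd p : odd (vp p). Proof. exact: P_odd (valP p). Qed.

(** The empty product 1 only has prime factors in P. *)
Lemma outside_gt2 n : outside P n -> (2 < n)%N.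
Proof.
case=> n_odd nP; case: n n_odd nP => [|[|[|n]]] // _ nP; case: nP => p.
by rewrite dvdn1 => /eqP p1; have := valP p; rewrite p1.
Qed.

(** Dividing by a prime of P keeps a prime factor outside P; in particular the
    quotient cannot drop to 1, where restriction would be truncated to 0. *)
Lemma outside_div p n : outside P (vp p * n) -> outside P n.
Proof.
case; rewrite oddM => /andP[_ n_odd] pnP; split=> // nP; apply: pnP => r.
rewrite Euclid_dvdM ?(valP r) // => /orP[|/nP //].
rewrite dvdn_prime2 ?(valP r) ?(valP (val p)) // => /eqP/val_inj ->.
exact: (valP p).
Qed.

Lemma chrM_even v n a t : M v -> ~~ odd n -> chr n a t v = 0.
Proof.
move=> Mv n_even; apply: contrapT => /(M_chr Mv)[n_odd _].
by rewrite n_odd in n_even.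
Qed.

Lemma chrM_refl v n a : M v -> chr n a true v = chr n 0 true v.
Proof.
move=> Mv; have [n_odd|n_even] := boolP (odd n); first exact: chr_refl.
by rewrite !chrM_even.
Qed.

(** On M the truncation of restriction is invisible: where it would occur, the
    character of v vanishes already. *)
Lemma chrM_Res p v n a t : M v -> chr n a t (Res (val p) v) = chr (vp p * n) (vp p * a) t v.
Proof.
move=> Mv; rewrite chr_Res; case: ifPn => // n_le2; apply: esym; apply: contrapT.
move=> /(M_chr Mv)/outside_div/outside_gt2; exact/negP.
Qed.

Lemma chrM_Ind p v n a t : M v -> chr n a t (Ind (val p) v) =
  if (vp p %| n)%N && (t || (vp p %| a)%N) then
    weight C vp t p * chr (n %/ vp p) (rotdiv t a (vp p)) t v else 0.
Proof.
move=> Mv; case: t; rewrite /weight /rotdiv /=; last exact: chr_Ind_rot.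
rewrite andbT mul1r; have [n_odd|n_even] := boolP (odd n); first exact: chr_Ind_refl.
rewrite chrM_even //; last exact: Ind_mem.
case: ifP => // /dvdnP[k nE]; rewrite nE mulnK // chrM_even //.
by move: n_even; rewrite nE oddM vp_odd andbT.
Qed.

End Relations.

(** * Ordered monomials and a criterion for a basis *)

Section OrderedProducts.
Variables (A : pzRingType) (I : choiceType) (rk : I -> nat).
Hypothesis rk_inj : injective rk.
Local Notation expoI := {fsfun I -> nat with 0%N}.
Local Notation leI := (relpre rk leq).
Implicit Types (k : expoI) (x : I -> A).

Definition oprod x k : A := \prod_(p <- sort leI (finsupp k)) x p ^+ k p.

(** Factors with exponent 0 are 1, so the product may be taken over any larger
    finite set of indices; since rk is injective, sorting is insensitive to the
    way in which that set is enumerated. *)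
Lemma oprod_widen x k (S : {fset I}) : (finsupp k `<=` S)%fset ->
  oprod x k = \prod_(p <- sort leI S) x p ^+ k p.
Proof.
move=> /fsubsetP kS.
have leI_total : total leI by move=> p q; apply: leq_total.
have leI_trans : transitive leI by move=> p q r; apply: leq_trans.
have leI_anti : antisymmetric leI by move=> p q /anti_leq/rk_inj.
transitivity (\prod_(p <- sort leI S | p \in finsupp k) x p ^+ k p); last first.
  rewrite [LHS]big_mkcond; apply: eq_bigr => p _.
  by case: ifPn => // pk; rewrite fsfun_dflt // expr0.
rewrite -big_filter filter_sort //; congr (\big[_/_]_(p <- _) _).
apply/perm_sortP => //; apply: uniq_perm; rewrite ?filter_uniq ?fset_uniq //.
by move=> p; rewrite mem_filter andb_idr //; apply: kS.
Qed.

Lemma oprod0 x : oprod x [fsfun] = 1.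
Proof. by rewrite (@oprod_widen _ _ fset0) ?finsupp0 // big_nil. Qed.

Definition bump_expo (p : I) k : expoI := [fsfun k with p |-> (k p).+1].

Lemma bump_expoE p k q : bump_expo p k q = (k q + (q == p))%N.
Proof. by rewrite fsfun_withE; case: eqP => [->|_]; rewrite ?addn1 ?addn0. Qed.

(** The factor x p is moved through the preceding factors to its own place. *)
Lemma oprod_bump x k p : (forall p q, x p * x q = x q * x p) ->
  oprod x (bump_expo p k) = x p * oprod x k.
Proof.
move=> xC; pose S := (p |` finsupp k)%fset.
have kS : (finsupp k `<=` S)%fset by apply: fsubsetUr.
have k'S : (finsupp (bump_expo p k) `<=` S)%fset.
  by rewrite finsupp_with fsubset_refl.
have : p \in sort leI S by rewrite mem_sort fset1U1.
have : uniq (sort leI S) by rewrite sort_uniq fset_uniq.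
rewrite (oprod_widen _ kS) (oprod_widen _ k'S).
elim: (sort leI S) => // q s IHs /= /andP[qs s_uniq].
rewrite inE !big_cons bump_expoE; have [qp|neq_pq] := eqVneq q p.
  rewrite qp in qs *; move=> _; rewrite addn1 exprS -mulrA; congr (_ * (_ * _)).
  apply: eq_big_seq => r rs; rewrite bump_expoE.
  case: eqP => [rp|_]; last by rewrite addn0.
  by rewrite -rp rs in qs.
rewrite addn0 /= => ps; rewrite IHs // !mulrA.
by congr (_ * _); apply/esym/commrX/xC.
Qed.

Lemma oprod_comm a x k : (forall p, k p <> 0%N -> a * x p = x p * a) ->
  a * oprod x k = oprod x k * a.
Proof.
move=> axC; rewrite /oprod big_seq; apply: commr_prod => p.
rewrite mem_sort mem_finsupp => /eqP kp; exact/commrX/axC.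
Qed.

End OrderedProducts.

(** Here r and i are the restriction and induction elements of A, and J an ideal
    modulo which r p * i p is the scalar c p. *)
Section MonomialBasis.
Variables (C : fieldType) (A : algType C) (J : idealType A).
Variables (I : choiceType) (rk : I -> nat) (r i : I -> A) (c : I -> C).
Local Notation expoI := {fsfun I -> nat with 0%N}.
Local Notation leI := (relpre rk leq).
Hypothesis rk_inj : injective rk.
Hypothesis rC : forall p q, r p * r q = r q * r p.
Hypothesis iC : forall p q, i p * i q = i q * i p.
Hypothesis ri_neq : forall p q, p != q -> r p * i q = i q * r p.
Hypothesis ri_eq : forall p, r p * i p - (c p)%:A \in J.
Hypothesis generation : forall Q : A -> Prop, Q 1 ->
  (forall a x y, Q x -> Q y -> Q (a *: x + y)) ->
  (forall p x, Q x -> Q (r p * x)) -> (forall p x, Q x -> Q (i p * x)) ->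
  forall x, Q x.

Definition mono (lk : expoI * expoI) : A := oprod rk i lk.1 * oprod rk r lk.2.
Local Notation pmono := (fun lk => qproj J (mono lk)).

(** The span of the monomials contains 1 and is stable under left multiplication
    by the generators: i p increases an exponent, and r p either passes through
    all the factors i q or meets a factor i p, with which it becomes c p. *)
Lemma mono_span x : exists m : {malg C[(expoI * expoI)%type]}, qproj J x = lincomb pmono m.
Proof.
pose span (u : quotalg J) := exists m, u = lincomb pmono m.
have span_lin a u v : span u -> span v -> span (a *: u + v).
  by move=> [m ->] [m' ->]; exists (a *: m + m'); rewrite linearP.
have span0 : span 0 by exists 0; rewrite linear0.
have span_mono lk : span (pmono lk) by exists << lk >>; rewrite lincombU scale1r.
have spanM z : (forall lk, span (qproj J (z * mono lk))) ->
    forall x, span (qproj J x) -> span (qproj J (z * x)).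
  move=> z_mono y [m yE]; rewrite -qprojM yE /lincomb mulr_sumr.
  elim/big_rec: _ => // lk u _ span_u.
  by rewrite -quot_scalerAr qprojM; apply: span_lin.
apply: (generation (Q := fun x => span (qproj J x))) => //.
- have -> : 1 = mono ([fsfun], [fsfun]) by rewrite /mono !oprod0 ?mulr1.
  exact: span_mono.
- by move=> a y z span_y span_z; rewrite raddfD /= -qprojZ; apply: span_lin.
- move=> p; apply: spanM => -[l k]; have [lp|lp] := eqVneq (l p) 0%N.
    rewrite /mono mulrA (@oprod_comm _ _ rk (r p) i) => [|q lq]; last first.
      by apply: ri_neq; apply: contra_not_neq lq => <-.
    rewrite -mulrA -oprod_bump //.
    exact: (span_mono (l, bump_expo p k)).
  pose l' : expoI := [fsfun l with p |-> (l p).-1].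
  have lE : l = bump_expo p l'.
    apply/fsfunP => q; rewrite bump_expoE fsfun_withE.
    by case: eqP => [->|_]; rewrite ?addn0 // addn1 prednK // lt0n.
  rewrite /mono lE oprod_bump //= !mulrA.
  have -> : qproj J (r p * i p * oprod rk i l' * oprod rk r k) =
            c p *: pmono (l', k).
    rewrite qprojZ; apply/qprojP => /=.
    have -> : r p * i p * oprod rk i l' * oprod rk r k - c p *: mono (l', k) =
              (r p * i p - (c p)%:A) * mono (l', k).
      by rewrite mulrBl mulr_algl /mono !mulrA.
    by apply: idealMr; apply: ri_eq.
  by rewrite -[_ *: _]addr0; apply: span_lin.
move=> p; apply: spanM => -[l k].
rewrite /mono mulrA -oprod_bump //.
exact: (span_mono (bump_expo p l, k)).
Qed.

(* The vectors X n, for n satisfying ok, span a module on which the monomials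
   act by shifting the index, and coef reads a coordinate. *)
Variables (V : lmodType C) (act : A -> V -> V) (d : I -> nat) (n0 : nat).
Variables (X : nat -> V) (ok : nat -> Prop) (coef : nat -> {linear V -> C^o}).
Hypothesis c_neq0 : forall p, c p != 0.
Hypothesis act1 : forall n, ok n -> act 1 (X n) = X n.
Hypothesis actM : forall x y n, ok n -> act (x * y) (X n) = act x (act y (X n)).
Hypothesis act_lin : forall a x y n, ok n ->
  act (a *: x + y) (X n) = a *: act x (X n) + act y (X n).
Hypothesis actZr : forall a x v, act x (a *: v) = a *: act x v.
Hypothesis d_prime : forall p, prime (d p).
Hypothesis d_inj : injective d.
Hypothesis n0_d : forall p, ~~ (d p %| n0)%N.
Hypothesis ok_n0 : ok n0.
Hypothesis ok_i : forall p n, ok n -> ok (d p * n).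
Hypothesis ok_r : forall p n, ok n -> (d p %| n)%N -> ok (n %/ d p).
Hypothesis act_i : forall p n, ok n -> act (i p) (X n) = X (d p * n).
Hypothesis act_r : forall p n, ok n ->
  act (r p) (X n) = if (d p %| n)%N then c p *: X (n %/ d p) else 0.
Hypothesis J_act : forall x n, x \in J -> ok n -> act x (X n) = 0.
Hypothesis coef_X : forall k k', (0 < k)%N -> (0 < k')%N ->
  (coef (k * n0) (X (k' * n0)) == 0) = (k != k').

Let act0 n : ok n -> act 0 (X n) = 0.
Proof. by move=> ok_n; have := act_lin (-1) 1 1 ok_n; rewrite !scaleN1r !addNr. Qed.

Let act0r x : act x 0 = 0.
Proof. by have := actZr 0 x 0; rewrite !scale0r. Qed.

Let d_gt0 p : (0 < d p)%N. Proof. exact: prime_gt0. Qed.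

Definition dprod s (k : expoI) : nat := \prod_(p <- s) d p ^ k p.
Definition dexp (k : expoI) : nat := dprod (sort leI (finsupp k)) k.

Lemma dprod_gt0 s k : (0 < dprod s k)%N.
Proof. by apply: prodn_gt0 => p; rewrite expn_gt0 d_gt0. Qed.

Lemma logn_dprod s k p : uniq s -> logn (d p) (dprod s k) = if p \in s then k p else 0%N.
Proof.
rewrite /dprod; elim: s => [|q s IHs] /=; first by rewrite big_nil logn1.
case/andP=> qs s_uniq; rewrite big_cons inE lognM ?expn_gt0 ?d_gt0 ?dprod_gt0 //.
rewrite IHs // lognX logn_prime // (inj_eq d_inj).
have [->|_] := eqVneq p q; first by rewrite (negPf qs) muln1 addn0.
by rewrite muln0.
Qed.

Lemma dexp_inj : injective dexp.
Proof.
move=> k k' eq_kk'; apply/fsfunP => p.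
have lognE (l : expoI) : logn (d p) (dexp l) = l p.
  rewrite logn_dprod ?sort_uniq ?fset_uniq // mem_sort.
  by case: finsuppP.
by rewrite -[LHS]lognE -[RHS]lognE eq_kk'.
Qed.

Lemma coprime_dexp k : coprime (dexp k) n0.
Proof.
rewrite /dexp /dprod; elim/big_rec: _ => [|p m _ co_m]; first exact: coprime1n.
by rewrite coprimeMl co_m andbT coprimeXl // prime_coprime.
Qed.

Lemma act_i_prod s (l : expoI) n : ok n ->
  ok (dprod s l * n) /\ act (\prod_(p <- s) i p ^+ l p) (X n) = X (dprod s l * n).
Proof.
move=> ok_n; rewrite /dprod; elim: s => [|p s [ok_s IHs]].
  by rewrite !big_nil mul1n act1.
rewrite !big_cons actM // IHs -mulnA; move: (_ * n)%N ok_s => {n ok_n IHs} n ok_n.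
elim: (l p) => [|e [ok_e IHe]]; first by rewrite mul1n act1.
by rewrite exprS actM // IHe act_i // expnS -mulnA; split=> //; apply: ok_i.
Qed.

Definition cprod s (k : expoI) : C := \prod_(p <- s) c p ^+ k p.

(** A product of restrictions divides the index by the corresponding product of
    primes, or gives 0 if the division is not exact. *)
Lemma act_r_prod s (k : expoI) n : ok n ->
  act (\prod_(p <- s) r p ^+ k p) (X n) =
    (if (dprod s k %| n)%N then cprod s k *: X (n %/ dprod s k) else 0) /\
  ((dprod s k %| n)%N -> ok (n %/ dprod s k)).
Proof.
have act_rX p e m : ok m ->
    act (r p ^+ e) (X m) = (if (d p ^ e %| m)%N then c p ^+ e *: X (m %/ d p ^ e) else 0) /\
    ((d p ^ e %| m)%N -> ok (m %/ d p ^ e)).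
  move=> ok_m; elim: e => [|e [IHe ok_e]]; first by rewrite dvd1n divn1 scale1r act1.
  rewrite exprS actM // IHe expnS; case: ifPn ok_e => [em /(_ isT) ok_e|em _]; last first.
    rewrite act0r ifN; first by
      split=> // /(dvdn_trans (dvdn_mull _ (dvdnn _))); rewrite (negPf em).
    by apply: contra em; apply: dvdn_trans (dvdn_mull _ _).
  rewrite actZr -dvdn_divRL // [(d p * _)%N]mulnC divnMA act_r //.
  split=> [|pm]; first by case: ifP; rewrite ?scaler0 // scalerA -exprSr.
  exact: ok_r.
move=> ok_n; rewrite /dprod /cprod; elim: s => [|p s [IHs ok_s]].
  by rewrite !big_nil dvd1n divn1 scale1r act1.
rewrite !big_cons actM // {}IHs; case: ifPn ok_s => [sn /(_ isT) ok_s|sn _]; last first.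
  rewrite act0r ifN; first by
    split=> // /(dvdn_trans (dvdn_mull _ (dvdnn _))); rewrite (negPf sn).
  by apply: contra sn; apply: dvdn_trans (dvdn_mull _ _).
rewrite actZr -dvdn_divRL // [(d p ^ k p * _)%N]mulnC divnMA.
have [-> ok_p] := act_rX p (k p) _ ok_s.
by split=> //; case: ifP; rewrite ?scaler0 // scalerA mulrC.
Qed.

Lemma act_mono lk n : ok n -> act (mono lk) (X n) =
  if (dexp lk.2 %| n)%N then
    cprod (sort leI (finsupp lk.2)) lk.2 *: X (dexp lk.1 * (n %/ dexp lk.2)) else 0.
Proof.
move=> ok_n; rewrite /mono actM //.
have [-> ok_div] := act_r_prod (sort leI (finsupp lk.2)) lk.2 ok_n.
case: ifPn ok_div => [_ /(_ isT) ok_q|_ _]; last by rewrite act0r.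
by rewrite actZr; have [_ ->] := act_i_prod (sort leI (finsupp lk.1)) lk.1 ok_q.
Qed.

(** Among the pairs (l, k) of the support take one with dexp k minimal, and apply
    the combination to X at dexp k * n0. As n0 is prime to dexp k', a term
    (l', k') survives only if dexp k' divides dexp k, hence if k' = k; its image
    is then a multiple of X at dexp l' * n0, and reading the coordinate at
    dexp l * n0 isolates the coefficient of (l, k). *)
Lemma mono_free m : lincomb mono m \in J -> m = 0.
Proof.
move=> mJ; have [/eqP|/fset0Pn[lk1 m_lk1]] := boolP (msupp m == fset0).
  by move=> m0; apply/malgP => lk; rewrite mcoeff0 mcoeff_outdom // m0 inE.
exfalso.
have ex_n : exists n, has (fun lk => dexp lk.2 == n) (msupp m).
  by exists (dexp lk1.2); apply/hasP; exists lk1.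
case: (ex_minnP ex_n) => _ /hasP[[l k] m_lk /= /eqP<-] k_min.
pose n := (dexp k * n0)%N.
have ok_n : ok n by have [] := act_i_prod (sort leI (finsupp k)) k ok_n0.
have /(congr1 (coef (dexp l * n0))) := J_act mJ ok_n.
have act_sum s (F : expoI * expoI -> A) :
    act (\sum_(lk <- s) F lk) (X n) = \sum_(lk <- s) act (F lk) (X n).
  elim: s => [|lk s IHs]; first by rewrite !big_nil act0.
  by rewrite !big_cons -[F lk]scale1r act_lin // !scale1r IHs.
rewrite {1}/lincomb act_sum linear_sum linear0.
have termE lk : lk \in msupp m ->
    coef (dexp l * n0) (act (m@_lk *: mono lk) (X n)) =
    if lk == (l, k) then
      m@_(l, k) * (cprod (sort leI (finsupp k)) k * coef (dexp l * n0) (X (dexp l * n0)))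
    else 0.
  move=> m_lk'; have -> : act (m@_lk *: mono lk) (X n) = m@_lk *: act (mono lk) (X n).
    by rewrite -[_ *: mono lk]addr0 act_lin // act0 // addr0.
  rewrite linearZ /= act_mono // /n Gauss_dvdl; last exact: coprime_dexp.
  case: lk m_lk' => l' k' /= m_lk'; rewrite xpair_eqE.
  case: ifPn => [k'k|k'k]; last first.
    have -> : (k' == k) = false by apply: contraNF k'k => /eqP->.
    by rewrite andbF linear0 scaler0.
  have -> : k' = k.
    apply: dexp_inj; apply/eqP; rewrite eqn_leq dvdn_leq ?dprod_gt0 //=.
    by apply: k_min; apply/hasP; exists (l', k').
  rewrite eqxx andbT linearZ /= mulKn ?dprod_gt0 //.
  have [->|neq_l] := eqVneq l' l; first by [].
  have /eqP-> : coef (dexp l * n0) (X (dexp l' * n0)) == 0.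
    by rewrite coef_X ?dprod_gt0 // eq_sym; apply: contra_neq neq_l => /dexp_inj.
  by rewrite !scaler0.
rewrite (eq_big_seq _ termE) (bigD1_seq (l, k)) ?fset_uniq //= eqxx.
rewrite big1 => [|lk /negPf-> //]; rewrite addr0 => /eqP; apply/negP.
have coef_neq0 : coef (dexp l * n0) (X (dexp l * n0)) != 0.
  by rewrite coef_X ?dprod_gt0 // negbK.
rewrite !mulf_neq0 ?mcoeff_neq0 // /cprod prodf_seq_neq0.
by apply/allP => p _; rewrite expf_neq0.
Qed.

Theorem mono_basis : is_basis (fun lk => qproj J (mono lk)).
Proof.
move=> u; have [x ->] := qprojE u; have [m mE] := mono_span x; exists m; split=> // m' m'E.
have lincombE m1 : lincomb pmono m1 = qproj J (lincomb mono m1).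
  rewrite /lincomb raddf_sum; apply: eq_bigr => lk _; exact: qprojZ.
apply/eqP; rewrite -subr_eq0; apply/eqP/mono_free.
by rewrite linearB; apply/qprojP; rewrite -!lincombE -mE.
Qed.

End MonomialBasis.

(** * Complementary central idempotents *)

Section CentralIdempotents.
Variables (C : fieldType) (A : algType C).
Implicit Types (e x y z : A).

(** The ideal of a central idempotent e is A e. *)
Lemma gen_idealZ_idem e (c : C) y : c != 0 -> (forall z, z * e = e * z) -> e * e = e ->
  (y \in gen_ideal (c *: e)) = (y * e == y).
Proof.
move=> c_neq0 eC ee; apply/idP/eqP => [/asboolP[s ->]|yE].
  rewrite mulr_suml; apply: eq_bigr => -[a b] _ /=.
  by rewrite -[LHS]mulrA eC mulrA -[a * _ * e]mulrA -scalerAl ee.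
apply/asboolP; exists [:: (c^-1 *: y, 1)].
by rewrite big_seq1 /= mulr1 -scalerAl -scalerAr scalerA mulVf // scale1r yE.
Qed.

Lemma central_generation (I : Type) (g h : I -> A) e :
    (forall Q : A -> Prop, Q 1 ->
      (forall a x y, Q x -> Q y -> Q (a *: x + y)) ->
      (forall p x, Q x -> Q (g p * x)) -> (forall p x, Q x -> Q (h p * x)) ->
      forall x, Q x) ->
    (forall p, g p * e = e * g p) -> (forall p, h p * e = e * h p) ->
  forall z, z * e = e * z.
Proof.
move=> generation gC hC; apply: generation => [|a x y xC yC|p x xC|p x xC].
- by rewrite mul1r mulr1.
- by rewrite mulrDl mulrDr -scalerAl -scalerAr xC yC.
- by rewrite -mulrA xC !mulrA gC.
by rewrite -mulrA xC !mulrA hC.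
Qed.

(** The element x plays the role of Res_p Ind_p, with eigenvalues 1 and n; e1 and
    e2 are the projections onto its eigenspaces for n and for 1. *)
Section ComplementaryIdempotents.
Variables (x : A) (n : nat).
Hypothesis n_neq1 : n%:R - 1 != 0 :> C.
Let e1 := (n%:R - 1 : C)^-1 *: (x - 1).
Let e2 := (n%:R - 1 : C)^-1 *: (n%:R - x).
Hypothesis e1C : forall z, z * e1 = e1 * z.
Hypothesis e1e1 : e1 * e1 = e1.

Lemma compl_idemD : e1 + e2 = 1.
Proof.
rewrite /e1 /e2 -scalerDr.
have -> : x - 1 + (n%:R - x) = n%:R - 1 by rewrite addrC addrA subrK.
have -> : n%:R - 1 = (n%:R - 1 : C) *: (1 : A).
  by rewrite scalerBl scaler_nat scale1r.
by rewrite scalerA mulVf ?scale1r.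
Qed.

Let e2E : e2 = 1 - e1. Proof. by rewrite -compl_idemD addrC addKr. Qed.

Lemma compl_idem_sub1 : x - 1 = (n%:R - 1 : C) *: e1.
Proof. by rewrite scalerA mulfV // scale1r. Qed.

Lemma compl_idem_subn : x - n%:R = (1 - n%:R : C) *: e2.
Proof. by rewrite -[1 - _]opprB scaleNr scalerA mulfV // scale1r opprB. Qed.

(** The element x - n is a nonzero multiple of e2, so it generates A e2, the
    annihilator of e1. *)
Lemma gen_ideal_compl_n z : (z \in gen_ideal (x - n%:R)) = (z * e1 == 0).
Proof.
rewrite compl_idem_subn gen_idealZ_idem.
- by rewrite e2E mulrBr mulr1 -subr_eq0 addrAC subrr add0r oppr_eq0.
- by rewrite -opprB oppr_eq0.
- by move=> y; rewrite e2E mulrBl mulrBr mulr1 mul1r e1C.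
by rewrite e2E mulrBr mulr1 mulrBl mul1r e1e1 subrr subr0.
Qed.

Lemma gen_ideal_compl_1 z : (z \in gen_ideal (x - 1)) = (z * e2 == 0).
Proof.
rewrite compl_idem_sub1 gen_idealZ_idem // e2E mulrBr mulr1.
by rewrite -subr_eq0 -oppr_eq0 opprB.
Qed.

End ComplementaryIdempotents.

Variables (e1 e2 : A) (J1 J2 : idealType A).
Hypothesis e1D2 : e1 + e2 = 1.
Hypothesis e1C : forall z, z * e1 = e1 * z.
Hypothesis e1e1 : e1 * e1 = e1.
Hypothesis J1E : forall y, (y \in J1) = (y * e1 == 0).
Hypothesis J2E : forall y, (y \in J2) = (y * e2 == 0).

Let e2E : e2 = 1 - e1. Proof. by rewrite -e1D2 addrC addKr. Qed.
Let e2C z : z * e2 = e2 * z.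
Proof. by rewrite e2E mulrBl mulrBr mulr1 mul1r e1C. Qed.
Let e1e2 : e1 * e2 = 0. Proof. by rewrite e2E mulrBr mulr1 e1e1 subrr. Qed.
Let e2e1 : e2 * e1 = 0. Proof. by rewrite e1C e1e2. Qed.
Let e2e2 : e2 * e2 = e2. Proof. by rewrite {1}e2E mulrBl mul1r e1e2 subr0. Qed.

Lemma in_leftidealM e z : z * e \in in_leftideal e.
Proof. by apply/asboolP; exists z. Qed.

Definition split_idem z : leftideal2 e1 e2 :=
  (LeftIdeal (in_leftidealM e1 z), LeftIdeal (in_leftidealM e2 z)).

Lemma split_idem_is_linear : linear split_idem.
Proof.
by move=> a x y; congr (_, _); apply: val_inj; rewrite /= mulrDl scalerAl.
Qed.
HB.instance Definition _ :=
  GRing.isLinear.Build C A (leftideal2 e1 e2) _ split_idem split_idem_is_linear.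

Definition split_quot (x : leftideal2 e1 e2) : (quotalg J1 * quotalg J2)%type :=
  (qproj J1 (val x.1), qproj J2 (val x.2)).

Lemma split_quot_is_linear : linear split_quot.
Proof.
by move=> a x y; congr (_, _); rewrite /= qprojZ -raddfD.
Qed.
HB.instance Definition _ :=
  GRing.isLinear.Build C (leftideal2 e1 e2) (quotalg J1 * quotalg J2)%type _
    split_quot split_quot_is_linear.

Let leftidealK e (x : leftideal e) : e * e = e -> val x * e = val x.
Proof. by move=> ee; have /asboolP[z ->] := valP x; rewrite -mulrA ee. Qed.

Lemma split_idem_bij : bijective split_idem.
Proof.
exists (fun x : leftideal2 e1 e2 => val x.1 + val x.2) => [z|[x y]] /=.
  by rewrite -mulrDr e1D2 mulr1.
congr (_, _); apply: val_inj; rewrite /= mulrDl.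
  by rewrite leftidealK // -(leftidealK y) // -mulrA e2e1 mulr0 addr0.
by rewrite (leftidealK y) // -(leftidealK x) // -mulrA e1e2 mulr0 add0r.
Qed.

(** A representative of a class modulo J1 is determined up to A e2, so its
    product with e1 only depends on the class. *)
Lemma split_quot_bij : bijective split_quot.
Proof.
pose rep1 (u : quotalg J1) : A := generic_quotient.repr u.
pose rep2 (u : quotalg J2) : A := generic_quotient.repr u.
have repK1 z : rep1 (qproj J1 z) * e1 = z * e1.
  apply/esym/eqP; rewrite -subr_eq0 -mulrBl -J1E; exact: qproj_reprB.
have repK2 z : rep2 (qproj J2 z) * e2 = z * e2.
  apply/esym/eqP; rewrite -subr_eq0 -mulrBl -J2E; exact: qproj_reprB.
exists (fun u => (LeftIdeal (in_leftidealM e1 (rep1 u.1)),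
                  LeftIdeal (in_leftidealM e2 (rep2 u.2)))).
  move=> [x y]; congr (_, _); apply: val_inj => /=.
    by rewrite repK1 leftidealK.
  by rewrite repK2 leftidealK.
move=> [u w]; have [x ->] := qprojE u; have [y ->] := qprojE w.
rewrite /split_quot /= repK1 repK2; congr (_, _); apply/qprojP.
  by rewrite J1E mulrBl -mulrA e1e1 subrr.
by rewrite J2E mulrBl -mulrA e2e2 subrr.
Qed.

Lemma split_quot_idem z : split_quot (split_idem z) = (qproj J1 z, qproj J2 z).
Proof.
congr (_, _); apply/qprojP => /=; first by rewrite J1E mulrBl -mulrA e1e1 subrr.
by rewrite J2E mulrBl -mulrA e2e2 subrr.
Qed.

Lemma split_idemM z w :
  split_idem (z * w) = leftideal_mul2 (split_idem z) (split_idem w).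
Proof.
congr (_, _); apply: val_inj => /=.
  by rewrite -[RHS]mulrA [e1 * _]mulrA -e1C -!mulrA e1e1.
by rewrite -[RHS]mulrA [e2 * _]mulrA -e2C -!mulrA e2e2.
Qed.

Lemma split_quotM (x y : leftideal2 e1 e2) :
  split_quot (leftideal_mul2 x y) = split_quot x * split_quot y.
Proof. by congr (_, _); rewrite /= -qprojM. Qed.

End CentralIdempotents.

(** * Test vectors *)

Section TestVectors.
Variable C : numClosedFieldType.

Lemma sign_mx_repr n (s : bool) :
  mx_repr [set: dih n] (fun g => ((-1) ^+ (s && g.2))%:M : 'M[C]_1).
Proof.
split=> [|x y _ _]; first by rewrite andbF.
by rewrite -scalar_mxM -signr_addb dihM -andb_addr.
Qed.
Definition sign_repr n s := MxRepresentation (sign_mx_repr n s).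

Lemma chr_sign (m : ge3) n a s t :
  chr n a t (cls (sign_repr (val m) s)) = if val m == n then (-1) ^+ (s && t) else 0.
Proof. by rewrite chr_cls /= mxtrace_scalar. Qed.

(** For t = false, half the regular character: n on the identity and 0 elsewhere.
    For t = true, half the difference of the trivial and the sign characters: 1
    on reflections and 0 on rotations. *)
Definition test_cls (t : bool) (m : ge3) : groth C :=
  2^-1 *: (if t then cls (sign_repr (val m) false) - cls (sign_repr (val m) true)
           else cls (regular_repr C [set: dih (val m)])).

Definition test_vec (t : bool) (n : nat) : groth C :=
  if insub n is Some m then test_cls t m else 0.

Definition test_val (t : bool) (n a : nat) : C :=
  if t then 1 else if (n %| a)%N then n%:R else 0.

Lemma chr_test_vec t n n' a t' : chr n' a t' (test_vec t n) =
  if [&& (2 < n)%N, n == n' & t == t'] then test_val t n a else 0.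
Proof.
rewrite /test_vec; case: insubP => [m n_gt2 mE|/negPf->]; last by rewrite linear0.
rewrite n_gt2 linearZ /= -mE; case: t; rewrite /test_val.
  transitivity (2^-1 * ((if val m == n' then 1 else 0) -
                        (if val m == n' then (-1) ^+ t' else 0)) : C).
    congr (_ * _); apply: etrans (linearB _ _ _) _.
    by congr (_ - _); [apply: (chr_sign m n' a false t') | apply: (chr_sign m n' a true t')].
  case: (val m == n'); last by rewrite subrr mulr0.
  case: t'; last by rewrite subrr mulr0.
  by rewrite expr1 opprK; apply: mulVf; rewrite pnatr_eq0.
rewrite chr_cls; case: eqP => _; last by rewrite scaler0.
rewrite mxtrace_regularE -cardsT card_dih ?(ltnW (valP m)) // [_ == 1%g]xpair_eqE.
have -> : (a%:R == 0 :> 'Z_(val m)) = (val m %| a)%N.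
  by rewrite -val_eqE /= val_Zp_nat // (ltnW (valP m)).
case: t'; rewrite /= ?andbF ?andbT; first by rewrite mulr0n scaler0.
case: ifP => _; last by rewrite mulr0n scaler0.
by rewrite mulr1n natrM; apply: mulKf; rewrite pnatr_eq0.
Qed.

End TestVectors.

Section SubmodCls.
Variables (C : numClosedFieldType) (P : {pred primeT}) (M : nzsubmod C P).

Lemma submod_sum (I : Type) (s : seq I) (Q : pred I) (F : I -> groth C) :
  (forall i, Q i -> M (F i)) -> M (\sum_(i <- s | Q i) F i).
Proof. by move=> MF; elim/big_ind: _ => //; [apply: submod0 | apply: submodD]. Qed.

Lemma test_vec_mem t n :
  (forall b : simpleCls C, val (tag b) = n -> M (cls_simple b)) -> M (test_vec C t n).
Proof.
move=> M_n; rewrite /test_vec; case: insubP => [m _ mE|_]; last exact: submod0.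
have M_cls d (rG : mx_representation C [set: dih (val m)] d) : M (cls rG).
  by apply: submod_sum => i _; apply/submodZ/M_n.
apply: submodZ; case: t => //.
by rewrite -scaleN1r; apply: submodD => //; apply: submodZ.
Qed.

End SubmodCls.

(** * The relations of the quotient algebra *)

Section Main.
Variables (C : numClosedFieldType) (P : {pred primeT}) (M : nzsubmod C P).
Hypothesis P_odd : forall p, p \in P -> odd (val p).
Hypothesis M_chr : forall v n a t, M v -> chr n a t v <> 0 -> outside P n.
Implicit Types (v w : groth C) (z : quotA M) (p q : primeIn P).
Local Notation vp := (@prime_val P).

Let vp_prime p : prime (vp p). Proof. exact: (valP (val p)). Qed.
Let vp_gt0 p : (0 < vp p)%N. Proof. exact: prime_gt0. Qed.
Let vp_inj : injective vp. Proof. by move=> p q /val_inj/val_inj. Qed.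
Let vp_coprime p q : p != q -> coprime (vp p) (vp q).
Proof. by move=> neq; rewrite prime_coprime // dvdn_prime2 // (inj_eq vp_inj). Qed.

Let chr_res := chrM_Res M_chr.
Let chr_ind := chrM_Ind P_odd M_chr.

Let qact_comp z1 z2 f1 f2 v : M v ->
  (forall v, M v -> qact z1 v = f1 v) -> (forall v, M v -> qact z2 v = f2 v) ->
  qact (z1 * z2) v = f1 (f2 v).
Proof.
move=> Mv z1E z2E; have Mv2 : M (f2 v) by rewrite -z2E //; apply: qact_mem.
exact: etrans (qactMul _ _ Mv) (etrans (congr1 (qact z1) (z2E v Mv)) (z1E _ Mv2)).
Qed.

(** An identity of the quotient may be checked on M, where it follows from the
    character formulas. *)
Lemma resQC p q : resQ M p * resQ M q = resQ M q * resQ M p.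
Proof.
apply: qact_inj => v Mv.
have E p1 p2 := qact_comp Mv (qact_res p1) (qact_res p2).
apply: etrans (E p q) (etrans _ (esym (E q p))).
exact: (resC (@Res_mem _ _ M) (@chr_ext C) chr_res).
Qed.

Lemma indQC p q : indQ M p * indQ M q = indQ M q * indQ M p.
Proof.
apply: qact_inj => v Mv.
have E p1 p2 := qact_comp Mv (qact_ind p1) (qact_ind p2).
apply: etrans (E p q) (etrans _ (esym (E q p))).
exact: (indC (@Ind_mem _ _ M) (@chr_ext C) chr_ind).
Qed.

Lemma resQ_indQ_neq p q : p != q -> resQ M p * indQ M q = indQ M q * resQ M p.
Proof.
move=> neq_pq; apply: qact_inj => v Mv.
apply: etrans (qact_comp Mv (qact_res p) (qact_ind q)) _.
apply: etrans _ (esym (qact_comp Mv (qact_ind q) (qact_res p))).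
exact: (res_ind_neq vp_coprime (@Res_mem _ _ M) (@Ind_mem _ _ M) (@chr_ext C) chr_res chr_ind).
Qed.

Lemma chr_res_ind p v n a t : M v ->
  chr n a t (qact (resQ M p * indQ M p) v) = weight C vp t p * chr n a t v.
Proof.
move=> Mv; rewrite (qact_comp Mv (qact_res p) (qact_ind p)).
exact: (ch_res_ind vp_gt0 (@Ind_mem _ _ M) (chrM_refl M_chr) chr_res chr_ind).
Qed.

Lemma quotA_ext z1 z2 :
  (forall v, M v -> forall n a t, chr n a t (qact z1 v) = chr n a t (qact z2 v)) ->
  z1 = z2.
Proof. by move=> eq_z; apply: qact_inj => v Mv; apply: chr_ext; apply: eq_z. Qed.

Let vp_neq1 p : (vp p)%:R - 1 != 0 :> C.
Proof. by rewrite subr_eq0 pnatr_eq1 gtn_eqF // prime_gt1. Qed.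

(** In character coordinates eps1 kills the reflection part and fixes the
    rotation part, because Res_p Ind_p is 1 on the former and p on the latter. *)
Lemma chr_eps1 p v n a t : M v ->
  chr n a t (qact (eps1 M p) v) = if t then 0 else chr n a t v.
Proof.
move=> Mv; rewrite /eps1 (qactZ _ _ Mv) (qactB _ _ Mv) (qact1 Mv) linearZ linearB /=.
rewrite chr_res_ind //; case: t; rewrite /weight ?mul1r ?subrr ?scaler0 //.
rewrite -[X in _ *: (_ - X)]mul1r -mulrBl; exact: mulKf (vp_neq1 p) _.
Qed.

Lemma eps1_indep p q : eps1 M p = eps1 M q.
Proof.
apply: quotA_ext => v Mv n a t.
exact: etrans (chr_eps1 p n a t Mv) (esym (chr_eps1 q n a t Mv)).
Qed.

Lemma eps1_idem p : eps1 M p * eps1 M p = eps1 M p.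
Proof.
apply: quotA_ext => v Mv n a t; rewrite (qactMul _ _ Mv).
apply: etrans (chr_eps1 p n a t (qact_mem (eps1 M p) Mv)) _.
by case: t; first exact/esym/chr_eps1.
Qed.

Lemma resQ_eps1 p q : resQ M p * eps1 M q = eps1 M q * resQ M p.
Proof.
apply: quotA_ext => v Mv n a t; have Mev := qact_mem (eps1 M q) Mv.
apply: etrans (congr1 (chr n a t) (qactMul _ _ Mv)) _.
apply: etrans (congr1 (chr n a t) (qact_res p Mev)) _.
apply: etrans (chr_res p n a t Mev) _; apply: etrans (chr_eps1 q _ _ t Mv) _.
apply: esym; apply: etrans (congr1 (chr n a t) (qactMul _ _ Mv)) _.
apply: etrans (chr_eps1 q n a t (qact_mem (resQ M p) Mv)) _.
by case: t => //; rewrite (qact_res p Mv) (chr_res p n a false Mv).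
Qed.

Lemma indQ_eps1 p q : indQ M p * eps1 M q = eps1 M q * indQ M p.
Proof.
apply: quotA_ext => v Mv n a t; have Mev := qact_mem (eps1 M q) Mv.
apply: etrans (congr1 (chr n a t) (qactMul _ _ Mv)) _.
apply: etrans (congr1 (chr n a t) (qact_ind p Mev)) _.
apply: etrans (chr_ind p n a t Mev) _; rewrite (chr_eps1 q _ _ t Mv).
apply: esym; apply: etrans (congr1 (chr n a t) (qactMul _ _ Mv)) _.
apply: etrans (chr_eps1 q n a t (qact_mem (indQ M p) Mv)) _.
case: t; first by rewrite mulr0; case: ifP.
by rewrite (qact_ind p Mv) (chr_ind p n a false Mv).
Qed.

Lemma eps1_central q z : z * eps1 M q = eps1 M q * z.
Proof.
exact: central_generation (@quotA_ind _ _ M) (fun p => resQ_eps1 p q)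
  (fun p => indQ_eps1 p q) z.
Qed.

Lemma eps1D2 q : eps1 M q + eps2 M q = 1.
Proof. exact: compl_idemD (vp_neq1 q). Qed.

Lemma eps2_indep p q : eps2 M p = eps2 M q.
Proof.
apply: (addrI (eps1 M q)); apply: etrans _ (esym (eps1D2 q)).
exact: etrans (congr1 (fun x => x + eps2 M p) (eps1_indep q p)) (eps1D2 p).
Qed.

Lemma J1E p q z : (z \in J1 M p) = (z * eps1 M q == 0).
Proof.
rewrite -(eps1_indep p q).
exact: gen_ideal_compl_n (vp_neq1 p) (eps1_central p) (eps1_idem p) z.
Qed.

Lemma J2E p q z : (z \in J2 M p) = (z * eps2 M q == 0).
Proof.
rewrite -(eps2_indep p q).
exact: gen_ideal_compl_1 (vp_neq1 p) (eps1_central p) (eps1_idem p) z.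
Qed.

Let test_val_neq0 t n : (0 < n)%N -> test_val C t n 0 != 0.
Proof. by rewrite /test_val dvdn0 lt0n; case: t; rewrite ?oner_eq0 ?pnatr_eq0. Qed.

Lemma chr_test_vec_neq0 t n a : (2 < n)%N -> test_val C t n a != 0 ->
  chr n a t (test_vec C t n) <> 0.
Proof.
by move=> n_gt2 /eqP val_neq0; rewrite chr_test_vec n_gt2 !eqxx.
Qed.

Lemma test_val_ind t p n n' a t' : (2 < n)%N ->
  (if (vp p %| n')%N && (t' || (vp p %| a)%N) then
     weight C vp t' p *
       (if [&& (2 < n)%N, n == (n' %/ vp p)%N & t == t']
        then test_val C t n (rotdiv t' a (vp p)) else 0)
   else 0) =
  if [&& (2 < vp p * n)%N, (vp p * n)%N == n' & t == t'] then test_val C t (vp p * n) a else 0.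
Proof.
move=> n_gt2; have pn_gt2 : (2 < vp p * n)%N by rewrite (leq_trans n_gt2) ?leq_pmull.
rewrite n_gt2 pn_gt2 /=; have [<-|] := eqVneq t t'; last first.
  by rewrite !andbF mulr0 if_same.
rewrite !andbT; have [/dvdnP[k ->]|pn'] := boolP (vp p %| n')%N; last first.
  by have -> // : (vp p * n == n')%N = false by apply: contraNF pn' => /eqP<-; apply: dvdn_mulr.
rewrite mulnK // [(k * _)%N]mulnC eqn_pmul2l //=.
have [_|_] := eqVneq n k; last by rewrite mulr0 if_same.
rewrite /weight /rotdiv /test_val; case: t => /=; first by rewrite mulr1.
have [/dvdnP[b ->]|pa] := boolP (vp p %| a)%N; last first.
  by have -> // : (vp p * n %| a)%N = false by
    apply: contraNF pa; apply: dvdn_trans (dvdn_mulr _ _).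
rewrite mulnK // [(b * _)%N]mulnC dvdn_pmul2l //.
by case: ifP => _; rewrite ?mulr0 // natrM.
Qed.

Lemma test_val_res t p n n' a t' : (2 < n)%N -> ((vp p %| n)%N -> (2 < n %/ vp p)%N) ->
  (if [&& (2 < n)%N, n == (vp p * n')%N & t == t'] then test_val C t n (vp p * a) else 0) =
  if (vp p %| n)%N then
    weight C vp t p * (if [&& (2 < n %/ vp p)%N, (n %/ vp p)%N == n' & t == t']
                       then test_val C t (n %/ vp p) a else 0)
  else 0.
Proof.
move=> n_gt2 np_gt2; rewrite n_gt2 /=.
have [pn|pn] := boolP (vp p %| n)%N; last first.
  by have -> // : (n == vp p * n')%N = false by apply: contraNF pn => /eqP->; apply: dvdn_mulr.
rewrite np_gt2 //; case/dvdnP: pn {n_gt2 np_gt2} => m ->; rewrite mulnK //=.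
rewrite [(m * _)%N]mulnC eqn_pmul2l //; case: ifP => _; last by rewrite mulr0.
rewrite /weight /test_val; case: t; first by rewrite mulr1.
by rewrite dvdn_pmul2l //; case: ifP => _; rewrite ?mulr0 // natrM.
Qed.

(** The index n can be used when the test vector lies in M; the first condition
    prevents the zero vector from qualifying. *)
Definition test_ok (t : bool) n : Prop := outside P n /\ M (test_vec C t n).

Lemma Ind_test_vec t p n : test_ok t n ->
  Ind (val p) (test_vec C t n) = test_vec C t (vp p * n).
Proof.
case=> out_n MX; apply: chr_ext => n' a t'.
apply: etrans (chr_ind p n' a t' MX) _.
rewrite [in LHS]chr_test_vec; apply: etrans _ (esym (chr_test_vec _ _ _ _ _ _)).
exact: test_val_ind (outside_gt2 out_n).
Qed.

Lemma Res_test_vec t p n : test_ok t n -> Res (val p) (test_vec C t n) =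
  if (vp p %| n)%N then weight C vp t p *: test_vec C t (n %/ vp p) else 0.
Proof.
case=> out_n MX; apply: chr_ext => n' a t'.
apply: etrans (chr_res p n' a t' MX) _; apply: etrans (chr_test_vec _ _ _ _ _ _) _.
rewrite (test_val_res t n' a t' (outside_gt2 out_n)) => [|pn]; last first.
  by apply: (@outside_gt2 P); apply: (@outside_div P p); rewrite mulnC divnK.
case: ifP => _; last by rewrite linear0.
by rewrite linearZ /= chr_test_vec.
Qed.

Lemma test_ok_mul t p n : test_ok t n -> test_ok t (vp p * n).
Proof.
move=> ok_n; have MX : M (test_vec C t (vp p * n)).
  by rewrite -Ind_test_vec //; apply: Ind_mem; case: ok_n.
have n_gt2 : (2 < n)%N by case: ok_n => /outside_gt2.
have pn_gt2 : (2 < vp p * n)%N by rewrite (leq_trans n_gt2) ?leq_pmull.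
split=> //; apply: M_chr MX (chr_test_vec_neq0 (a := 0) _ _) => //.
exact: test_val_neq0 (ltnW (ltnW pn_gt2)).
Qed.

Lemma weight_neq0 t p : weight C vp t p != 0.
Proof. by rewrite /weight; case: t; rewrite ?oner_eq0 // pnatr_eq0 -lt0n. Qed.

Lemma test_ok_div t p n : test_ok t n -> (vp p %| n)%N -> test_ok t (n %/ vp p).
Proof.
move=> ok_n pn; split.
  by apply: (@outside_div P p); rewrite mulnC divnK //; case: ok_n.
have [_ /(Res_mem p)] := ok_n; rewrite Res_test_vec // pn => /(submodZ (weight C vp t p)^-1).
by rewrite scalerA mulVf ?weight_neq0 // scale1r.
Qed.

Hypothesis M_full : forall v n a t, M v -> chr n a t v <> 0 ->
  forall b : simpleCls C, val (tag b) = n -> M (cls_simple b).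

(** Take n0 minimal among the n for which all the simple D_2n-modules lie in M.
    If a prime p of P divided n0, restricting a test vector by p would show that
    n0 / p is a smaller such n. *)
Lemma exists_test_ok : exists n0, (forall t, test_ok t n0) /\ forall p, ~~ (vp p %| n0)%N.
Proof.
pose full n := outside P n /\ forall b : simpleCls C, val (tag b) = n -> M (cls_simple b).
have ex_full : exists n, `[< full n >].
  have [v Mv v_neq0] := submod_neq0 M; apply: contrapT => no_full.
  apply: v_neq0; apply: chr_inj => n a t; apply: contrapT => chr_v; apply: no_full.
  by exists n; apply/asboolP; split; [apply: M_chr Mv chr_v | apply: M_full Mv chr_v].
case: (ex_minnP ex_full) => n0 /asboolP[out_n0 full_n0] n0_min.
have ok_n0 t : test_ok t n0 by split=> //; apply: test_vec_mem.
exists n0; split=> // p; apply/negP => pn0.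
have [out_q MXq] := test_ok_div (ok_n0 true) pn0.
have chr_q := chr_test_vec_neq0 (outside_gt2 out_q)
  (test_val_neq0 true (ltnW (ltnW (outside_gt2 out_q)))).
have full_q : `[< full (n0 %/ vp p)%N >].
  by apply/asboolP; split=> //; apply: M_full MXq chr_q.
have := n0_min _ full_q; rewrite leqNgt ltn_Pdiv ?prime_gt1 //.
exact: ltnW (ltnW (outside_gt2 out_n0)).
Qed.

(** If J kills every vector of M whose only nonzero part is the one of type t,
    then it kills the test vectors of type t, which separate the monomials. *)
Lemma test_vec_basis (rk : primeIn P -> nat) (rk_inj : injective rk) t (J : idealType (quotA M)) :
    (forall p, resQ M p * indQ M p - (weight C vp t p)%:A \in J) ->
    (forall z v, z \in J -> M v -> (forall n a, chr n a (~~ t) v = 0) -> qact z v = 0) ->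
  is_basis (fun lk => qproj J (monomial M rk lk)).
Proof.
move=> J_rel J_act; have [n0 [ok_n0 n0P]] := exists_test_ok.
have chr_other n n' a : chr n' a (~~ t) (test_vec C t n) = 0.
  by rewrite chr_test_vec; case: (t); rewrite !andbF.
have coef_X k k' : (0 < k)%N -> (0 < k')%N ->
    (chr (k * n0) 0 t (test_vec C t (k' * n0)) == 0) = (k != k').
  move=> k_gt0 k'_gt0; have n0_gt2 : (2 < n0)%N by apply: (@outside_gt2 P); case: (ok_n0 t).
  have kn0_gt0 j : (0 < j)%N -> (2 < j * n0)%N.
    by move=> j_gt0; rewrite (leq_trans n0_gt2) ?leq_pmull.
  rewrite chr_test_vec kn0_gt0 // eqxx andbT /= eqn_pmul2r ?(ltnW (ltnW n0_gt2)) // eq_sym.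
  have [_|_] := eqVneq k k'; last exact: eqxx.
  by apply: negbTE; rewrite eq_sym; apply: test_val_neq0; apply: ltnW (ltnW (kn0_gt0 _ k'_gt0)).
apply: (@mono_basis C (quotA M) J (primeIn P) rk (@resQ _ _ M) (@indQ _ _ M)
  (weight C vp t) rk_inj resQC indQC resQ_indQ_neq J_rel (@quotA_ind _ _ M)
  (groth C) (@qact _ _ M) vp n0 (test_vec C t) (test_ok t)
  (fun n => (chr n 0 t : {linear groth C -> C^o})) (weight_neq0 t)).
- by move=> n [_ Mn]; apply: qact1.
- by move=> x y n [_ Mn]; apply: qactMul.
- by move=> a x y n [_ Mn]; apply: etrans (qactD _ _ Mn) _; rewrite (qactZ _ _ Mn).
- by move=> a x v; apply: linearZ.
- exact: vp_prime.
- exact: vp_inj.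
- exact: n0P.
- exact: ok_n0.
- by move=> p n; apply: test_ok_mul.
- by move=> p n; apply: test_ok_div.
- by move=> p n ok_n; apply: etrans (qact_ind p (proj2 ok_n)) _; apply: Ind_test_vec.
- by move=> p n ok_n; apply: etrans (qact_res p (proj2 ok_n)) _; apply: Res_test_vec.
- by move=> z n zJ [_ Mn]; apply: J_act => // n' a; apply: chr_other.
exact: coef_X.
Qed.

End Main.

(** * The two quotients *)

Lemma mem_gen_ideal (A : pzRingType) (x : A) : x \in gen_ideal x.
Proof. by apply/asboolP; exists [:: (1, 1)]; rewrite big_seq1 /= mul1r mulr1. Qed.

Section Parts.
Variables (C : numClosedFieldType) (P : {pred primeT}) (M : nzsubmod C P).
Hypothesis P_odd : forall p, p \in P -> odd (val p).
Hypothesis M_chr : forall v n a t, M v -> chr n a t v <> 0 -> outside P n.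
Hypothesis M_full : forall v n a t, M v -> chr n a t v <> 0 ->
  forall b : simpleCls C, val (tag b) = n -> M (cls_simple b).

Lemma J1_rel p q :
  resQ M q * indQ M q - (weight C (@prime_val P) false q)%:A \in J1 M p.
Proof.
rewrite (J1E P_odd M_chr p q) -(J1E P_odd M_chr q q) scaler_nat.
exact: mem_gen_ideal.
Qed.

Lemma J2_rel p q :
  resQ M q * indQ M q - (weight C (@prime_val P) true q)%:A \in J2 M p.
Proof.
rewrite (J2E P_odd M_chr p q) -(J2E P_odd M_chr q q) scale1r.
exact: mem_gen_ideal.
Qed.

(** The idempotent eps1 fixes a vector whose character vanishes on reflections,
    and J1 is the annihilator of eps1. *)
Lemma J1_act p z v : z \in J1 M p -> M v -> (forall n a, chr n a true v = 0) ->
  qact z v = 0.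
Proof.
rewrite (J1E P_odd M_chr p p) => /eqP ze1 Mv v_refl.
have e1v : qact (eps1 M p) v = v.
  apply: chr_ext => n a t; apply: etrans (chr_eps1 P_odd M_chr p n a t Mv) _.
  by case: t; rewrite ?v_refl.
apply: etrans (congr1 (qact z) (esym e1v)) _.
apply: etrans (esym (qactMul _ _ Mv)) _.
by rewrite ze1 (qact0 Mv).
Qed.

Lemma J2_act p z v : z \in J2 M p -> M v -> (forall n a, chr n a false v = 0) ->
  qact z v = 0.
Proof.
rewrite (J2E P_odd M_chr p p) => /eqP ze2 Mv v_rot.
have e1v : qact (eps1 M p) v = 0.
  apply: chr_ext => n a t; apply: etrans (chr_eps1 P_odd M_chr p n a t Mv) _.
  by rewrite linear0; case: t; rewrite ?v_rot.
have e2v : qact (eps2 M p) v = v.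
  apply: etrans (esym (add0r _)) _.
  apply: etrans (congr1 (fun u => u + qact (eps2 M p) v) (esym e1v)) _.
  apply: etrans (esym (qactD _ _ Mv)) _.
  exact: etrans (congr1 (fun x => qact x v) (eps1D2 M p)) (qact1 Mv).
apply: etrans (congr1 (qact z) (esym e2v)) _.
apply: etrans (esym (qactMul _ _ Mv)) _.
by rewrite ze2 (qact0 Mv).
Qed.

End Parts.

Theorem theorem23 (R : realType) (P : {pred primeT})
    (P_nonempty : exists p, p \in P)
    (P_odd : forall p, p \in P -> odd (val p))
    (rk : primeIn P -> nat) (rk_indexing : indexing rk)
    (M : nzsubmod R[i] P)
    (M_span : exists B : simpleCls R[i] -> Prop,
        (forall b, B b -> odd (val (tag b))) /\ spanned_by M B)
    (M_all_or_none : forall n : ge3,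
        (forall b : simpleCls R[i], tag b = n -> M (cls_simple b)) \/
        (forall b : simpleCls R[i], tag b = n -> ~ M (cls_simple b)))
    (M_not_P : forall b : simpleCls R[i], M (cls_simple b) ->
        ~ (forall p : primeT, (val p %| val (tag b))%N -> p \in P)) :
  (forall p p' : primeIn P, J1 M p =i J1 M p' /\ J2 M p =i J2 M p') /\
  (forall p : primeIn P,
     is_basis (fun lk => pi1 M p (monomial M rk lk)) /\
     is_basis (fun lk => pi2 M p (monomial M rk lk))) /\
  (forall p q : primeIn P,
     exists (Phi : {linear quotA M -> leftideal2 (eps1 M q) (eps2 M q)})
            (Psi : {linear leftideal2 (eps1 M q) (eps2 M q) ->
                           (T1 M p * T2 M p)%type}),
       [/\ bijective Phi /\ bijective Psi,
           forall z, val (Phi z).1 = z * eps1 M q /\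
                     val (Phi z).2 = z * eps2 M q,
           forall z, Psi (Phi z) = (pi1 M p z, pi2 M p z),
           forall z w, Phi (z * w) = leftideal_mul2 (Phi z) (Phi w)
         & forall x y, Psi (leftideal_mul2 x y) = Psi x * Psi y]).
Proof.
have M_supp v n a t := @chr_outside _ _ _ M_span M_not_P v n a t.
have M_chr v n a t : M v -> chr n a t v <> 0 -> outside P n.
  by move=> Mv /(M_supp _ _ _ _ Mv)[b []].
have M_full v n a t : M v -> chr n a t v <> 0 ->
    forall b : simpleCls R[i], val (tag b) = n -> M (cls_simple b).
  move=> Mv /(M_supp _ _ _ _ Mv)[b [bn Mb _]] b' b'n.
  have bb' : tag b' = tag b by apply: val_inj; rewrite bn b'n.
  by case: (M_all_or_none (tag b)) => [M_b|no_b]; [exact: M_b bb' | case: (no_b b erefl)].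
split=> [p p'|].
  split=> z.
    exact: etrans (J1E P_odd M_chr p p z) (esym (J1E P_odd M_chr p' p z)).
  exact: etrans (J2E P_odd M_chr p p z) (esym (J2E P_odd M_chr p' p z)).
split=> [p|p q].
  split.
    apply: (test_vec_basis P_odd M_chr M_full (proj1 rk_indexing) (t := false)).
      exact: J1_rel P_odd M_chr p.
    by move=> z v; apply: J1_act P_odd M_chr _ _ _.
  apply: (test_vec_basis P_odd M_chr M_full (proj1 rk_indexing) (t := true)).
    exact: J2_rel P_odd M_chr p.
  by move=> z v; apply: J2_act P_odd M_chr _ _ _.
have e12 := eps1D2 M q.
have e1C := eps1_central P_odd M_chr q.
have e1e1 := eps1_idem P_odd M_chr q.
have J1z := J1E P_odd M_chr p q; have J2z := J2E P_odd M_chr p q.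
exists (split_idem (eps1 M q) (eps2 M q)),
  (@split_quot _ _ (eps1 M q) (eps2 M q) (J1 M p) (J2 M p)).
split.
- by split; [exact: split_idem_bij e12 e1C e1e1 | exact: split_quot_bij e12 e1e1 J1z J2z].
- by move=> z; split.
- exact: split_quot_idem e12 e1e1 J1z J2z.
- exact: split_idemM e12 e1C e1e1.
exact: split_quotM.
Qed.
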